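(* Let $T$ be an automorphism of a standard probability Borel space $(X,\mathcal{B},\mu)$, $G$ a second countable locally compact Abelian group, $\varphi:X\to G$ a measurable map, $\mathcal{S}=(S_g)_{g\in G}$ a $G$-action on a standard probability Borel space $(Y,\mathcal{C},\nu)$, and $T_{\varphi,\mathcal{S}}(x,y)=(Tx,S_{\varphi(x)}(y))$ on $(X\times Y,\mathcal{B}\otimes\mathcal{C},\mu\otimes\nu)$. Then $T_{\varphi,\mathcal{S}}$ is weakly mixing if and only if $T_{\varphi,\mathcal{S}}$ is ergodic, $T$ is weakly mixing, and $\mathcal{S}$ (acting on $L^2_0(Y,\mathcal{C},\nu)$) has no eigenvalues in $\Sigma_\varphi$.
   Context: An automorphism is an invertible measure-preserving transformation. A $G$-action is a measurable group homomorphism $g\mapsto S_g\in\mathrm{Aut}(Y,\mathcal{C},\nu)$. $L^2_0$ denotes the zero-mean functions in $L^2$. A character $\chi\in\widehat{G}$ is an eigenvalue of $\mathcal{S}$ on $L^2_0(Y,\mathcal{C},\nu)$ if there is a non-zero $g\in L^2_0(Y,\mathcal{C},\nu)$ with $g\circ S_h=\chi(h)g$ for all $h\in G$. With $\mathbb{T}=\{z\in\mathbb{C}:|z|=1\}$, $$\Sigma_\varphi=\{\chi\in\widehat{G}:\ \chi\circ\varphi=c\cdot\xi/\xi\circ T\ \ \mu\text{-a.e. for a measurable }\xi:X\to\mathbb{T}\text{ and some }c\in\mathbb{T}\}.$$ *)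

(* Defs.v *)
From HB Require Import structures.
From mathcomp Require Import all_boot all_order all_algebra.
From mathcomp Require Import all_classical all_reals all_analysis.
From mathcomp.real_closed Require Import complex.

Set Implicit Arguments.
Unset Strict Implicit.
Unset Printing Implicit Defensive.

Import Order.TTheory GRing.Theory Num.Theory numFieldNormedType.Exports.

Local Open Scope classical_set_scope.
Local Open Scope ring_scope.

Definition borel (Z : topologicalType) : set (set Z) := <<s @open Z >>.

(* The library's measurable_fun needs a pointed codomain carrying a sigma-
   algebra, which a topological group does not have out of the box. *)
Definition borel_measurable d (X : measurableType d) (Z : topologicalType)
    (f : X -> Z) : Prop :=
  forall B : set Z, borel B -> measurable (f @^-1` B).

(* R only serves as the value type of the pseudometric; a separated complete
   pseudometric space is a complete metric space. *)
Definition standard_borel (R : realType) d (X : measurableType d) : Prop :=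
  exists (P : completePseudoMetricType R) (f : X -> P),
    [/\ hausdorff_space P, @second_countable P, bijective f
      & forall A : set P, borel A <-> measurable (f @^-1` A)].

Section transformations.
Context {R : realType} d (X : measurableType d).
Implicit Types (mu : {measure set X -> \bar R}) (T : X -> X).

Definition measure_preserving mu T : Prop :=
  measurable_fun [set: X] T /\
  forall A, measurable A -> mu (T @^-1` A) = mu A.

(* As usual, transformations are considered modulo null sets, so the inverse
   is required only almost everywhere. *)
Definition automorphism mu T : Prop :=
  measure_preserving mu T /\
  exists T' : X -> X,
    [/\ measurable_fun [set: X] T',
        {ae mu, forall x, T' (T x) = x}
      & {ae mu, forall x, T (T' x) = x}].

Definition ergodic mu T : Prop :=
  forall A, measurable A -> mu ((T @^-1` A) `+` A) = 0%E ->
    mu A = 0%E \/ mu (~` A) = 0%E.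

Definition complex_measurable (f : X -> R[i]) : Prop :=
  measurable_fun [set: X] (fun x => complex.Re (f x)) /\
  measurable_fun [set: X] (fun x => complex.Im (f x)).

Definition square_integrable mu (f : X -> R[i]) : Prop :=
  complex_measurable f /\
  (\int[mu]_x ((complex.Re (f x)) ^+ 2 + (complex.Im (f x)) ^+ 2)%:E < +oo)%E.

Definition zero_mean mu (f : X -> R[i]) : Prop :=
  (\int[mu]_x (complex.Re (f x))%:E = 0)%E /\
  (\int[mu]_x (complex.Im (f x))%:E = 0)%E.

Definition L20 mu (f : X -> R[i]) : Prop :=
  square_integrable mu f /\ zero_mean mu f.

Definition nonzero mu (f : X -> R[i]) : Prop :=
  ~ {ae mu, forall x, f x = 0}.

(* The Koopman operator of T has no eigenvalue on L^2_0. *)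
Definition weakly_mixing mu T : Prop :=
  ~ exists (c : R[i]) (f : X -> R[i]),
    [/\ L20 mu f, nonzero mu f & {ae mu, forall x, f (T x) = c * f x}].

End transformations.

Definition character (R : realType) (G : topologicalZmodType)
    (chi : G -> R[i]) : Prop :=
  [/\ continuous (chi : G -> R[i]^o),
      forall g, `|chi g| = 1
    & forall g h, chi (g + h) = chi g * chi h].

(* A measurable homomorphism from G (written additively) to Aut(Y, nu), whose
   elements are taken modulo null sets. The Borel structure of Aut(Y, nu) is
   that of the weak topology; it is generated by the evaluations
   V |-> nu (A `&` V @^-1` B) with A and B measurable. Since this only
   constrains the class of each S g, joint measurability of (g, y) |-> S g y is
   not part of the definition. *)
Definition group_action (R : realType) (G : topologicalZmodType)
    d (Y : measurableType d) (nu : {measure set Y -> \bar R})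
    (S : G -> Y -> Y) : Prop :=
  [/\ forall g, automorphism nu (S g),
      forall g h, {ae nu, forall y, S (g + h) y = S g (S h y)}
    & forall A B : set Y, measurable A -> measurable B ->
      forall r : R, borel [set g : G | (nu (A `&` S g @^-1` B) < r%:E)%E]].

Definition action_eigenvalue (R : realType) (G : topologicalZmodType)
    d (Y : measurableType d) (nu : {measure set Y -> \bar R})
    (S : G -> Y -> Y) (chi : G -> R[i]) : Prop :=
  exists g : Y -> R[i],
    [/\ L20 nu g, nonzero nu g
      & forall h : G, {ae nu, forall y, g (S h y) = chi h * g y}].

Definition Sigma_cocycle (R : realType) (G : topologicalZmodType)
    d (X : measurableType d) (mu : {measure set X -> \bar R})
    (T : X -> X) (phi : X -> G) : set (G -> R[i]) :=
  [set chi | character chi /\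
    exists (c : R[i]) (xi : X -> R[i]),
      [/\ `|c| = 1, complex_measurable xi, forall x, `|xi x| = 1
        & {ae mu, forall x, chi (phi x) = c * (xi x / xi (T x))}]].

Definition skew_product (G X Y : Type) (T : X -> X) (phi : X -> G)
    (S : G -> Y -> Y) (z : X * Y) : X * Y :=
  (T z.1, S (phi z.1) z.2).

(* Main.v *)
Require Import Defs.
From HB Require Import structures.
From mathcomp Require Import all_boot all_order all_algebra.
From mathcomp Require Import all_classical all_reals all_analysis.
From mathcomp Require Import measurable_realfun.
From mathcomp Require Import ring lra.
From mathcomp.real_closed Require Import complex.

(* If the skew product W is ergodic and F is an eigenfunction, normalised to have
   modulus 1, then for every g the function F o (id x S_g) is an eigenfunction with
   the same eigenvalue c, because G is Abelian and so W commutes with id x S_g.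
   Hence F o (id x S_g) = chi(g) F for a scalar chi(g), and chi is a homomorphism.
   Integrating F in x over a suitable set gives an eigenfunction f of S for chi, and
   pairing F with f in y gives xi with chi(phi x) xi(T x) = c xi(x). If chi were
   trivial, xi would be an eigenfunction of T. Continuity of chi comes from Baire
   category (Pettis): the sets {g : nu(B n S_g^-1 B') > 0}, for B and B' level sets
   of a discretisation of f, are Borel, countably many of them cover G, and chi is
   almost constant on each.
   Conversely, eigenfunctions of W are obtained by lifting those of T and from the
   products xi(x) f(y). *)

Set Implicit Arguments.
Unset Strict Implicit.
Unset Printing Implicit Defensive.

Import Order.TTheory GRing.Theory Num.Theory numFieldNormedType.Exports.

Local Open Scope classical_set_scope.
Local Open Scope ring_scope.

(** The identities of the action hold only almost everywhere, with a null set depending on the group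
    element, and the action is not assumed jointly measurable. At a fixed point y nothing is known
    about g -> f(S_g y). The only regularity in g is that of the numbers nu(A n S_g^-1 B), so the
    continuity argument is phrased entirely through them. Normalising an eigenfunction to modulus 1
    destroys its zero mean. The zero mean is traded for the fact that the eigenvalue differs from 1,
    and it is recovered at the end from the invariance of the integral: if h o V = k h with k
    different from 1, then the integral of h equals k times itself. The integral of F in x over the
    whole of X may vanish, hence the restriction to a set A. The same A shows that xi does not
    vanish identically: if f0(y) is the integral of F(., y) over A and f = f0/|f0|, then exchanging
    integrals turns the integral of |f0| into the integral over A of the pairing of F(x, .) with
    f. *)

Local Notation Re := complex.Re.
Local Notation Im := complex.Im.

(** * Baire category and automatic continuity *)

Section baire_category.
Context {T : topologicalType}.
Implicit Types (A C U : set T).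

Lemma locally_compact_baire (D : (set T)^nat) :
  hausdorff_space T -> locally_compact [set: T] ->
  (forall n, open (D n) /\ dense (D n)) -> dense (\bigcap_n D n).
Proof.
move=> hT lcT oD O O0 oO.
have shrink U n : U !=set0 -> open U ->
    exists V, [/\ V !=set0, open V, compact (closure V) & closure V `<=` U `&` D n].
  move=> U0 oU; have [oDn dDn] := oD n.
  have [x UDx] := dDn U U0 oU.
  have [K + [cK clK]] := lcT x I.
  rewrite /within/= => Kx.
  have {}Kx : nbhs x K by apply: filterS Kx => y; apply.
  have UDKx : nbhs x ((U `&` D n) `&` K).
    apply: filterI => //; apply: open_nbhs_nbhs; split => //; exact: openI.
  have [B Bx BUDK] := compact_regular hT cK Kx UDKx.
  exists B°; split.
  - by exists x.
  - exact: open_interior.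
  - apply: (subclosed_compact _ cK); first exact: closed_closure.
    by move=> y /(closureS (@interior_subset _ B)) /BUDK [].
  - by move=> y /(closureS (@interior_subset _ B)) /BUDK [].
(* The premises sit inside [P], so that [choice] gives a total function, arbitrary on empty or
   non-open input. *)
pose P (q : set T * nat) V := q.1 !=set0 -> open q.1 ->
  [/\ V !=set0, open V, compact (closure V) & closure V `<=` q.1 `&` D q.2].
have /choice[f Pf] : forall q, exists V, P q V.
  move=> [U n]; case: (pselect (U !=set0 /\ open U)) => [[U0 oU]|nU].
    by have [V HV] := shrink U n U0 oU; exists V.
  by exists set0 => U0 oU; case: nU.
pose fix V n := if n is m.+1 then f (V m, m.+1) else f (O, 0%N).
have V0 : [/\ V 0%N !=set0, open (V 0%N), compact (closure (V 0%N))
    & closure (V 0%N) `<=` O `&` D 0%N] by exact: Pf.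
have VP n : V n !=set0 /\ open (V n).
  elim: n => [|n [Vn oVn]]; first by case: V0.
  by have [] := Pf (V n, n.+1) Vn oVn.
have VS n : closure (V n.+1) `<=` V n `&` D n.+1.
  by have [Vn oVn] := VP n; have [] := Pf (V n, n.+1) Vn oVn.
have VD m n : (m <= n)%N -> V n `<=` V m.
  elim: n => [|n IH]; first by rewrite leqn0 => /eqP ->.
  rewrite leq_eqVlt => /orP[/eqP -> //|/IH VnVm].
  by move=> x /subset_closure /VS [/VnVm].
(* Compactness replaces completeness: the decreasing sets [V n] generate a filter that clusters in
   [closure (V 0)], and its cluster point lies in every [closure (V n)]. *)
pose F := filter_from [set: nat] V.
have FF : ProperFilter F.
  apply: filter_from_proper; last by move=> n _; case: (VP n).
  apply: filter_from_filter; first by exists 0%N.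
  move=> i j _ _; exists (maxn i j) => //; rewrite subsetI; split; apply: VD.
    exact: leq_maxl.
  exact: leq_maxr.
have [_ _ cV0 V0OD] := V0.
have [|p [p0 clp]] := cV0 F FF.
  by exists 0%N => //; exact: subset_closure.
have clV n : closure (V n) p.
  by move=> B Bp; apply: clp => //; exists n.
exists p; split; first by have [] := V0OD p (clV 0%N).
move=> [|n] _; first by have [] := V0OD p (clV 0%N).
by have [] := VS n p (clV n.+1).
Qed.

Definition comeager C :=
  exists2 D : (set T)^nat, forall n, open (D n) /\ dense (D n) &
    \bigcap_n D n `<=` C.

Lemma comeager_open_dense C : open C -> dense C -> comeager C.
Proof. by move=> oC dC; exists (fun=> C) => // x /(_ 0%N); exact. Qed.

Lemma comeagerS A C : A `<=` C -> comeager A -> comeager C.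
Proof. by move=> AC [D oD DA]; exists D => // x /DA /AC. Qed.

Lemma comeager_bigcap (C : (set T)^nat) :
  (forall n, comeager (C n)) -> comeager (\bigcap_n C n).
Proof.
move=> cC.
have /choice[D DP] n : exists D : (set T)^nat,
    (forall k, open (D k) /\ dense (D k)) /\ \bigcap_k D k `<=` C n.
  by have [D] := cC n; exists D.
(* The double sequence is listed along codes of pairs; a number that codes no pair gets [setT],
   which is open and dense. *)
pose E k := if @unpickle (nat * nat)%type k is Some (i, j) then D i j else setT.
exists E => [k|x Ex i _].
  rewrite /E; case: unpickle => [[i j]|]; first exact: (DP i).1.
  split; first exact: openT.
  by move=> O O0 _; rewrite setIT.
apply: (DP i).2 => j _.
by have := Ex (pickle (i, j)) I; rewrite /E pickleK.
Qed.

Lemma comeagerI A C : comeager A -> comeager C -> comeager (A `&` C).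
Proof.
move=> cA cC.
have cAC n : comeager (if n is 0%N then A else C) by case: n.
apply: comeagerS (comeager_bigcap cAC) => x AC; split; first exact: (AC 0%N I).
exact: (AC 1%N I).
Qed.

Definition baire_property A :=
  exists2 U, open U & comeager [set x | A x <-> U x].

Lemma borel_baire_property A : borel A -> baire_property A.
Proof.
apply: smallest_sub A => [|U oU]; last first.
  exists U => //; apply: (@comeagerS setT) => //.
  by apply: comeager_open_dense => [|O O0 _]; [exact: openT|rewrite setIT].
have cT : comeager [set: T].
  by apply: comeager_open_dense => [|O O0 _]; [exact: openT|rewrite setIT].
split.
- by exists set0; [exact: open0|apply: comeagerS cT].
(* The complement of [U] need not be open. It is replaced by its interior, and the boundary of [U],
   which is nowhere dense, is discarded. *)
- move=> A [U oU cU]; exists (~` closure U).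
    by apply: closed_openC; exact: closed_closure.
  have cB : comeager (U `|` ~` closure U).
    apply: comeager_open_dense.
      by apply: openU => //; apply: closed_openC; exact: closed_closure.
    move=> O [x Ox] oO; have [[y [Uy Oy]]|OU] := pselect (U `&` O !=set0).
      by exists y; split => //; left.
    exists x; split => //; right => clUx; apply: OU; apply: clUx.
    exact: open_nbhs_nbhs.
  apply: comeagerS (comeagerI cU cB) => x /= [AU UcU].
  split => [[_ nAx] clUx|nclUx].
    by case: UcU => // /AU.
  by split => // Ax; apply: nclUx; apply: subset_closure; exact/AU.
- move=> A AP.
  have /choice[U UP] n : exists U, open U /\ comeager [set x | A n x <-> U x].
    by have [U] := AP n; exists U.
  exists (\bigcup_n U n); first by apply: bigcup_open => n _; exact: (UP n).1.
  apply: comeagerS (comeager_bigcap (fun n => (UP n).2)) => x /= AU.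
  by split=> -[n _ Hn]; exists n => //; apply/(AU n I).
Qed.

End baire_category.

Section pettis.
Context {G : topologicalZmodType}.

Lemma shift_continuous (t : G) : continuous (fun x : G => x + t).
Proof.
move=> x; apply: (@continuous_comp _ _ _ (fun x => (x, t)) (fun z => z.1 + z.2)).
  by apply: cvg_pair; [exact: cvg_id|exact: cvg_cst].
exact: add_continuous.
Qed.

Lemma open_shift (t : G) (U : set G) : open U -> open [set x | U (x + t)].
Proof. by move: U; apply/continuousP; exact: shift_continuous. Qed.

Lemma comeager_shift (t : G) (C : set G) :
  comeager C -> comeager [set x | C (x + t)].
Proof.
move=> [D oD DC]; exists (fun n => [set x | D n (x + t)]) => [n|x Dx].
  have [oDn dDn] := oD n; split.
    exact: (open_shift t oDn).
  move=> O [x Ox] oO.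
  have [||y [/= Oy Dy]] := dDn [set y | O (y - t)].
  - by exists (x + t); rewrite /= addrK.
  - exact: (open_shift (- t) oO).
  by exists (y - t); split => //=; rewrite subrK.
by apply: DC => n _; exact: Dx.
Qed.

(** By Baire some [A n] agrees, off a meagre set, with an open set containing a point [u]. For small
    [t] this open set and its translate by [-t] still share [u], and a generic point of their
    intersection lies in [A n] together with its translate by [t]. *)
Lemma pettis (A : (set G)^nat) :
  hausdorff_space G -> locally_compact [set: G] ->
  (forall n, borel (A n)) -> \bigcup_n A n = setT ->
  exists n, exists2 B : set G, open B /\ B 0 &
    forall t, B t -> exists x, A n x /\ A n (x + t).
Proof.
move=> hG lcG bA Acov.
have /choice[U UP] n : exists U, open U /\ comeager [set x | A n x <-> U x].
  by have [U] := borel_baire_property (bA n); exists U.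
have [n [u Uu]] : exists n, U n !=set0.
  apply: contrapT => U0.
  have [D oD DAU] := comeager_bigcap (fun n => (UP n).2).
  have [||x [_ /DAU AU]] := locally_compact_baire hG lcG oD (O := setT).
  - by exists 0.
  - exact: openT.
  have : [set: G] x by [].
  rewrite -Acov => -[n _ Anx]; apply: U0; exists n, x.
  exact/(AU n I).
exists n; have [oU cU] := UP n.
exists [set t | U n (t + u)] => [|t /= Uut].
  by rewrite /= add0r; split => //; exact: open_shift.
rewrite addrC in Uut.
have [D oD DAU] := comeagerI cU (comeager_shift t cU).
have [||x [[Ux Uxt] /DAU[/= AU AUt]]] :=
    locally_compact_baire hG lcG oD (O := U n `&` [set x | U n (x + t)]).
- by exists u.
- by apply: openI => //; exact: (open_shift t oU).
by exists x; split; [exact/AU|exact/AUt].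
Qed.

(** Differences within one piece fill a neighbourhood of 0, and |chi(x) - chi(x + t)| = |1 -
    chi(t)|, so the oscillation on that piece controls [chi] near 0, hence near every point. *)
Lemma borel_hom_continuous (R : realType) (I : countType) (chi : G -> R[i]) :
  hausdorff_space G -> locally_compact [set: G] ->
  (forall g, `|chi g| = 1) -> (forall g h, chi (g + h) = chi g * chi h) ->
  (forall e : R[i], 0 < e -> exists A : I -> set G,
    [/\ forall i, borel (A i), \bigcup_i A i = setT
      & forall i g h, A i g -> A i h -> `|chi g - chi h| < e]) ->
  continuous (chi : G -> R[i]^o).
Proof.
move=> hG lcG chi1 chiD chiA g; apply/cvgrPdist_lt => e e0.
have [A [bA covA Achi]] := chiA e e0.
pose A' n := if unpickle n is Some i then A i else set0.
have bA' n : borel (A' n).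
  rewrite /A'; case: unpickle => [i|]; first exact: bA.
  by have [] := smallest_sigma_algebra [set: G] (@open G).
have covA' : \bigcup_n A' n = setT.
  apply/seteqP; split => // x; rewrite -covA => -[i _ Aix].
  by exists (pickle i) => //; rewrite /A' pickleK.
have A'chi n x y : A' n x -> A' n y -> `|chi x - chi y| < e.
  by rewrite /A'; case: unpickle => // i; exact: Achi.
have [n [B [oB B0] BA]] := pettis hG lcG bA' covA'.
have Ag : nbhs g [set t | B (t - g)].
  by apply: open_nbhs_nbhs; split; [exact: open_shift|rewrite /= subrr].
apply: filterS Ag => t /= /BA[x [Ax Axt]].
have := A'chi _ _ _ Ax Axt.
have -> : chi t = chi g * chi (t - g) by rewrite -chiD addrC subrK.
by rewrite chiD -{1}(mulr1 (chi x)) -{1}(mulr1 (chi g)) -!mulrBr !normrM !chi1.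
Qed.

End pettis.

(** * Complex-valued measurable functions and measure-preserving maps *)

Section complex_measurable_theory.
Context {R : realType} {d} {X : measurableType d}.
Implicit Types (f g : X -> R[i]) (h : X -> R).

Lemma complex_measurable_cst (z : R[i]) : complex_measurable (fun _ : X => z).
Proof. by split; exact: measurable_cst. Qed.

Lemma complex_measurable_real h :
  measurable_fun setT h -> complex_measurable (fun x => (h x)%:C%C).
Proof. by split => //=; exact: measurable_cst. Qed.

Lemma complex_measurableM f g : complex_measurable f -> complex_measurable g ->
  complex_measurable (fun x => f x * g x).
Proof.
move=> [fR fI] [gR gI].
have mReM := measurable_funB (measurable_funM fR gR) (measurable_funM fI gI).
have mImM := measurable_funD (measurable_funM fR gI) (measurable_funM fI gR).
split; [move: mReM|move: mImM]; congr measurable_fun; apply/funext => x /=;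
  by case: (f x) (g x) => [a b] [u v].
Qed.

Lemma complex_measurable_conj f : complex_measurable f ->
  complex_measurable (fun x => (f x)^*%C).
Proof.
move=> [fR fI].
split; [move: fR|move: (measurableT_comp (@oppr_measurable R setT) fI)];
  congr measurable_fun; apply/funext => x /=; by case: (f x).
Qed.

Lemma complex_measurable_comp d' (Z : measurableType d') (u : Z -> X) f :
  measurable_fun setT u -> complex_measurable f ->
  complex_measurable (fun z => f (u z)).
Proof.
by move=> mu [fR fI]; split; [exact: measurableT_comp fR mu|exact: measurableT_comp fI mu].
Qed.

Lemma measurable_fun_eqc f g : complex_measurable f -> complex_measurable g ->
  measurable_fun setT (fun x => f x == g x).
Proof.
move=> [fR fI] [gR gI].
have := measurable_and (measurable_fun_eqr fR gR) (measurable_fun_eqr fI gI).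
by congr measurable_fun; apply/funext => x /=; rewrite eq_complex.
Qed.

Lemma measurable_eqc f g : complex_measurable f -> complex_measurable g ->
  measurable [set x | f x = g x].
Proof.
move=> mf mg; have := measurable_fun_eqc mf mg measurableT (Y := [set true]) I.
by congr measurable; apply/seteqP; split => x /=; [case=> _ /eqP|split=> //; exact/eqP].
Qed.

End complex_measurable_theory.

Section unitize.
Context {R : realType}.
Implicit Types z w : R[i].

(** The value 1 at 0 keeps the modulus equal to 1 at every point, so normalised functions are
    bounded without exceptional sets; multiplicativity then holds only away from 0. *)
Definition unitize z : R[i] := if z == 0 then 1 else z / `|z|.

Lemma norm_unitize z : `|unitize z| = 1.
Proof.
rewrite /unitize; case: eqP => [_|/eqP z0]; first exact: normr1.
by rewrite normrM normfV normr_id divff// normr_eq0.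
Qed.

Lemma unitizeM z w : z != 0 -> w != 0 -> unitize (z * w) = unitize z * unitize w.
Proof.
move=> z0 w0; rewrite /unitize mulf_eq0 (negPf z0) (negPf w0)/=.
by rewrite normrM invfM mulrACA.
Qed.

Lemma unitize_id z : `|z| = 1 -> unitize z = z.
Proof.
move=> z1; rewrite /unitize z1 divr1 -normr_eq0 z1.
by case: eqP => // /eqP; rewrite oner_eq0.
Qed.

(** Presents the modulus as a product with a unimodular factor. In this form |f| is seen to be
    measurable, and its integral becomes accessible to linearity and Fubini. *)
Lemma conj_unitizeM z : (unitize z)^*%C * z = `|z|.
Proof.
rewrite /unitize; case: eqP => [->|/eqP z0]; first by rewrite normr0 mulr0.
have nJ : ((`|z|^-1)^*)%C = `|z|^-1 by rewrite normc_def -fmorphV conjc_real.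
have -> : ((z / `|z|)^*)%C = (z^*)%C / `|z|.
  by rewrite [LHS]rmorphM; congr (_ * _); exact: nJ.
rewrite mulrAC [_ * z]mulrC -sqr_normc.
by rewrite expr2 mulfK// normr_eq0.
Qed.

Lemma complex_measurable_unitize d (X : measurableType d) (f : X -> R[i]) :
  complex_measurable f -> complex_measurable (fun x => unitize (f x)).
Proof.
move=> mf; have [fR fI] := mf.
(* The factor 1/|f| is the power -1/2 of |f|^2, measurable by composition; the zeros of [f] are
   handled by a separate branch. *)
have mn : measurable_fun setT
    (fun x => ((Re (f x)) ^+ 2 + (Im (f x)) ^+ 2) `^ (- 2^-1)).
  apply: (measurableT_comp (measurable_powR _)).
  by apply: measurable_funD; apply: measurable_funX.
have mb := measurable_fun_eqc mf (complex_measurable_cst 0).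
have [mR mI] := complex_measurableM mf (complex_measurable_real mn).
have E x : unitize (f x) = if f x == 0 then 1 else
    f x * (((Re (f x)) ^+ 2 + (Im (f x)) ^+ 2) `^ (- 2^-1))%:C%C.
  rewrite /unitize; case: eqP => // _; congr (_ * _).
  rewrite powRN powR12_sqrt ?addr_ge0 ?sqr_ge0// normc_def.
  by rewrite fmorphV.
split.
- have := measurable_fun_ifT mb (measurable_cst (1:R)) mR.
  by congr measurable_fun; apply/funext => x; rewrite E /=; case: ifP.
- have := measurable_fun_ifT mb (measurable_cst (0:R)) mI.
  by congr measurable_fun; apply/funext => x; rewrite E /=; case: ifP.
Qed.

Lemma norm_ReIm_le1 z : `|z| = 1 -> `|Re z| <= 1 /\ `|Im z| <= 1.
Proof.
move=> z1; split; rewrite -lecR.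
  by rewrite (le_trans (normc_ge_Re z))// z1.
have -> : Im z = Re (z * - 'i%C) by case: z {z1} => a b; simpc.
rewrite (le_trans (normc_ge_Re _))// normrM normrN z1 mul1r normc_def /=.
by rewrite expr0n/= add0r expr1n sqrtr1.
Qed.

End unitize.

Section measure_preserving_theory.
Context {R : realType}.

(* [measure_preserving] for a map between two different spaces, which also
   covers the coordinate projections. *)
Definition measure_map d d' (X : measurableType d) (Y : measurableType d')
    (mu : {measure set X -> \bar R}) (nu : {measure set Y -> \bar R}) (u : X -> Y) :=
  measurable_fun setT u /\ forall A, measurable A -> mu (u @^-1` A) = nu A.

Section transfer.
Context d d' (X : measurableType d) (Y : measurableType d').
Variables (mu : {measure set X -> \bar R}) (nu : {measure set Y -> \bar R}).
Variables (u : X -> Y).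
Hypothesis hu : measure_map mu nu u.

Lemma measure_map_ae (P : Y -> Prop) :
  {ae nu, forall y, P y} -> {ae mu, forall x, P (u x)}.
Proof.
move=> [N [mN N0 PN]]; exists (u @^-1` N); split.
- by rewrite -[_ @^-1` _]setTI; exact: hu.1.
- by rewrite -N0; exact: hu.2.
- by move=> x /= nPx; apply: PN.
Qed.

Lemma measure_map_pushforward (f : Y -> \bar R) :
  (\int[pushforward mu u]_y f y = \int[nu]_y f y)%E.
Proof. by apply: eq_measure_integral => [|? A mA _]; [exact: hu.1|exact: hu.2]. Qed.

Lemma ge0_integral_measure_map (f : Y -> \bar R) :
  measurable_fun setT f -> (forall y, 0 <= f y)%E ->
  (\int[mu]_x f (u x) = \int[nu]_y f y)%E.
Proof.
move=> mf f0; rewrite -measure_map_pushforward ge0_integral_pushforward//.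
exact: hu.1.
Qed.

Lemma integral_measure_map (f : Y -> \bar R) :
  measurable_fun setT f -> mu.-integrable setT (f \o u) ->
  (\int[mu]_x f (u x) = \int[nu]_y f y)%E.
Proof.
move=> mf fi; rewrite -measure_map_pushforward integral_pushforward//.
exact: hu.1.
Qed.

End transfer.
End measure_preserving_theory.

(** * Almost everywhere statements on a product space *)

Section product_almost_everywhere.
Context {R : realType} {dX dY} {X : measurableType dX} {Y : measurableType dY}.
Variables (mu : probability X R) (nu : probability Y R).

Lemma measure_map_fst : measure_map (mu \x nu)%E mu fst.
Proof.
split=> [|A mA]; first exact: measurable_fst.
rewrite (_ : fst @^-1` A = A `*` setT).
  by rewrite [LHS](product_measure1E mu nu)// [X in (_ * X)%E]probability_setT mule1.
by apply/seteqP; split => z /=; [|case].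
Qed.

Lemma measure_map_snd : measure_map (mu \x nu)%E nu snd.
Proof.
split=> [|A mA]; first exact: measurable_snd.
rewrite (_ : snd @^-1` A = setT `*` A).
  by rewrite [LHS](product_measure1E mu nu)// [X in (X * _)%E]probability_setT mul1e.
by apply/seteqP; split => z /=; [|case].
Qed.

(** The section over [x] of the preimage of [A] is the [V x]-preimage of the section of [A] over
    [T x]; invariance of [nu] and then of [mu] removes both maps. *)
Lemma measure_map_skew (T : X -> X) (V : X -> Y -> Y) :
  measurable_fun setT (fun z => (T z.1, V z.1 z.2)) ->
  measure_map mu mu T -> (forall x, measure_map nu nu (V x)) ->
  measure_map (mu \x nu)%E (mu \x nu)%E (fun z => (T z.1, V z.1 z.2)).
Proof.
move=> mW hT hV; split => // A mA.
transitivity (\int[mu]_x nu (xsection A (T x)))%E; last first.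
  exact: (ge0_integral_measure_map hT (measurable_fun_xsection nu mA)).
apply: eq_integral => x _ /=.
rewrite -((hV x).2 _ (measurable_xsection (T x) mA)).
by congr (nu _); apply/seteqP; split => y /=; rewrite /xsection/= !inE.
Qed.

Lemma product_negligibleP (A : set (X * Y)) : measurable A ->
  (mu \x nu)%E A = 0%E <-> {ae mu, forall x, nu (xsection A x) = 0%E}.
Proof.
move=> mA; have mx := measurable_fun_xsection nu mA.
have := ae_eq_integral_abs mu measurableT mx.
rewrite (_ : (\int[mu]_x `|_|)%E = (mu \x nu)%E A); last first.
  by apply: eq_integral => x _; rewrite gee0_abs.
move=> ->; split; apply: filterS => x /=; first exact.
by move=> ->.
Qed.

Lemma ae_product1 (P : X * Y -> Prop) :
  {ae (mu \x nu)%E, forall z, P z} ->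
  {ae mu, forall x, {ae nu, forall y, P (x, y)}}.
Proof.
move=> [N [mN /(product_negligibleP mN) N0 PN]].
apply: filterS N0 => x Nx; exists (xsection N x); split => //.
  exact: measurable_xsection.
by move=> y /= nP; rewrite /xsection/= inE; exact: PN.
Qed.

Lemma ae_product2 (P : X * Y -> Prop) :
  {ae (mu \x nu)%E, forall z, P z} ->
  {ae nu, forall y, {ae mu, forall x, P (x, y)}}.
Proof.
move=> [N [mN N0 PN]].
(* [mu \x nu] integrates over [X] the measures of sections; uniqueness of the product measure allows
   the other order. *)
have N20 : (\int[nu]_y mu (ysection N y) = 0)%E.
  transitivity ((mu \x^ nu)%E N) => //; rewrite -N0; apply/esym.
  by apply: product_measure_unique => // B C mB mC/=; rewrite product_measure2E.
have my := measurable_fun_ysection mu mN.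
have := (ae_eq_integral_abs nu measurableT my).1.
rewrite (_ : (\int[nu]_y `|_|)%E = \int[nu]_y mu (ysection N y))%E; last first.
  by apply: eq_integral => y _; rewrite gee0_abs.
move=> /(_ N20); apply: filterS => y /= /(_ I) Ny.
exists (ysection N y); split => //; first exact: measurable_ysection.
by move=> x /= nP; rewrite /ysection/= inE; exact: PN.
Qed.

(** Lifts identities in [y] whose null set varies with [x], as happens for [S (phi x)]. Fibrewise
    null sets need not be null without [mP], so each use first shows that the set is measurable. *)
Lemma product_ae (P : X * Y -> Prop) : measurable [set z | P z] ->
  {ae mu, forall x, {ae nu, forall y, P (x, y)}} ->
  {ae (mu \x nu)%E, forall z, P z}.
Proof.
move=> mP aeP; exists (~` [set z | P z]); split => //; first exact: measurableC.
apply/product_negligibleP; first exact: measurableC.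
apply: filterS aeP => x nuP; apply: measure_negligible.
  by apply: measurable_xsection; exact: measurableC.
by apply: negligibleS nuP => y; rewrite /xsection/= inE.
Qed.

End product_almost_everywhere.

(** * Bounded real functions: integrals, Fubini, determination by rectangles *)

Section bounded_measurable_real.
Context {R : realType}.

(** The bound holds everywhere and involves no measure, so it passes to every section and every
    composition. *)
Definition bounded_measurable d (X : measurableType d) (h : X -> R) :=
  measurable_fun setT h /\ exists M : R, forall x, `|h x| <= M.

Section one_space.
Context d (X : measurableType d) (mu : probability X R).
Implicit Type h : X -> R.

Lemma bounded_measurable_integrable h :
  bounded_measurable h -> mu.-integrable setT (EFin \o h).
Proof.
move=> [mh [M hM]]; apply: measurable_bounded_integrable => //.
  by rewrite (le_lt_trans (probability_le1 mu measurableT)) ?ltry.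
exists M; split; first exact: num_real.
by move=> N MN x _; exact: le_trans (hM x) (ltW MN).
Qed.

Lemma bounded_Rintegral h (M : R) : measurable_fun setT h ->
  (forall x, `|h x| <= M) -> `|\int[mu]_x h x| <= M.
Proof.
move=> mh hM.
have hi := bounded_measurable_integrable (conj mh (ex_intro _ M hM)).
apply: le_trans (le_normr_Rintegral measurableT hi) _.
have -> : M = \int[mu]_x cst M x.
  by rewrite Rintegral_cst// [X in fine X]probability_setT mulr1.
apply: le_Rintegral => //.
  by apply: bounded_measurable_integrable; split; [exact: measurableT_comp|
    exists M => x; rewrite normr_id].
apply: bounded_measurable_integrable; split; first exact: measurable_cst.
by exists `|M| => x /=.
Qed.

Lemma eq_ae_Rintegral h1 h2 : measurable_fun setT h1 -> measurable_fun setT h2 ->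
  {ae mu, forall x, h1 x = h2 x} -> \int[mu]_x h1 x = \int[mu]_x h2 x.
Proof.
move=> m1 m2 h12; congr fine; apply: ae_eq_integral => //.
- exact/measurable_EFinP.
- exact/measurable_EFinP.
- by apply: filterS h12 => x -> _.
Qed.

End one_space.

Lemma Rintegral_measure_map d d' (X : measurableType d) (Y : measurableType d')
    (mu : probability X R) (nu : probability Y R) (u : X -> Y) (h : Y -> R) :
  measure_map mu nu u -> bounded_measurable h ->
  \int[mu]_x h (u x) = \int[nu]_y h y.
Proof.
move=> hu [mh [M hM]]; congr fine.
apply: (integral_measure_map hu (f := EFin \o h)); first exact/measurable_EFinP.
apply: bounded_measurable_integrable; split; first exact: measurableT_comp hu.1.
by exists M => x /=.
Qed.

Section product.
Context dX dY (X : measurableType dX) (Y : measurableType dY).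
Variables (mu : probability X R) (nu : probability Y R) (h : X * Y -> R).
Hypothesis bh : bounded_measurable h.

Let ih : (mu \x nu)%E.-integrable setT (EFin \o h).
Proof. exact: (bounded_measurable_integrable (mu \x nu)%E). Qed.

Lemma bounded_measurable_section1 x : bounded_measurable (fun y => h (x, y)).
Proof.
have [mh [M hM]] := bh; split; first exact: measurableT_comp.
by exists M => y.
Qed.

Lemma bounded_measurable_section2 y : bounded_measurable (fun x => h (x, y)).
Proof.
have [mh [M hM]] := bh; split; first exact: measurableT_comp.
by exists M => x.
Qed.

Let E1 x : (\int[nu]_y (h (x, y))%:E = (\int[nu]_y h (x, y))%:E)%E.
Proof.
rewrite fineK//; apply: integrable_fin_num => //.
exact: (bounded_measurable_integrable nu (bounded_measurable_section1 x)).
Qed.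

Let E2 y : (\int[mu]_x (h (x, y))%:E = (\int[mu]_x h (x, y))%:E)%E.
Proof.
rewrite fineK//; apply: integrable_fin_num => //.
exact: (bounded_measurable_integrable mu (bounded_measurable_section2 y)).
Qed.

Lemma bounded_measurable_Rintegral1 :
  bounded_measurable (fun x => \int[nu]_y h (x, y)).
Proof.
split.
  apply/measurable_EFinP; have := measurable_fubini_F ih; congr measurable_fun.
  by apply/funext => x; exact: E1.
have [mh [M hM]] := bh; exists M => x.
by apply: bounded_Rintegral => //; exact: (bounded_measurable_section1 x).1.
Qed.

Lemma bounded_measurable_Rintegral2 :
  bounded_measurable (fun y => \int[mu]_x h (x, y)).
Proof.
split.
  apply/measurable_EFinP; have := measurable_fubini_G ih; congr measurable_fun.
  by apply/funext => y; exact: E2.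
have [mh [M hM]] := bh; exists M => y.
by apply: bounded_Rintegral => //; exact: (bounded_measurable_section2 y).1.
Qed.

Lemma Rintegral_prod1 :
  \int[mu]_x \int[nu]_y h (x, y) = \int[(mu \x nu)%E]_z h z.
Proof.
congr fine; rewrite -(integral12_prod_meas1 ih); apply: eq_integral => x _.
by rewrite -E1.
Qed.

Lemma Rintegral_prod2 :
  \int[nu]_y \int[mu]_x h (x, y) = \int[(mu \x nu)%E]_z h z.
Proof.
congr fine; rewrite -(integral21_prod_meas1 ih); apply: eq_integral => x _.
by rewrite -E2.
Qed.

End product.
End bounded_measurable_real.

Section rectangles.
Context {R : realType} {dX dY} {X : measurableType dX} {Y : measurableType dY}.
Variables (mu : probability X R) (nu : probability Y R).

(** Signed measures are avoided by a shift: for [M] bounding |h|, the density 1 + h/M is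
    nonnegative, and the measure it defines agrees with the product measure on rectangles.
    Uniqueness of the product measure makes them equal, so the density is 1 almost everywhere. *)
Lemma bounded_rectangle_eq0 (h : X * Y -> R) : bounded_measurable h ->
  (forall A B, measurable A -> measurable B ->
    \int[(mu \x nu)%E]_z (\1_A z.1 * \1_B z.2 * h z) = 0) ->
  {ae (mu \x nu)%E, forall z, h z = 0}.
Proof.
move=> [mh [M0 hM0]] hAB; set P := (mu \x nu)%E.
have [M [Mgt0 hM]] : exists M : R, 0 < M /\ forall z, `|h z| <= M.
  exists (`|M0| + 1); split=> [|z]; first by rewrite ltr_wpDl.
  by rewrite (le_trans (hM0 z))// (le_trans (ler_norm _))// lerDl.
pose g z := (1 + h z / M)%:E.
have g0 z : (0 <= g z)%E.
  rewrite lee_fin addrC -lerBlDr sub0r lerNl -mulNr ler_pdivrMr// mul1r.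
  by rewrite (le_trans (ler_norm _))// normrN.
have mg : measurable_fun setT g.
  apply/measurable_EFinP; apply: measurable_funD => //.
  by apply: measurable_funM.
pose m (E : set (X * Y)) := (\int[P]_(z in E) g z)%E.
have m0 : m set0 = 0%E by exact: integral_set0.
have mge0 E : (0 <= m E)%E by apply: integral_ge0.
have msa : semi_sigma_additive m.
  move=> F mF tF mUF; rewrite /m ge0_integral_bigcup//; last exact: measurable_funTS.
  by apply: is_cvg_ereal_nneg_natsum_cond => n _ _; exact: mge0.
pose m' : {measure set (X * Y) -> \bar R} :=
  HB.pack m (isMeasure.Build _ _ _ m m0 mge0 msa).
have b1 : bounded_measurable (fun _ : X * Y => 1 : R).
  by split; [exact: measurable_cst|exists 1 => z; rewrite normr1].
have gb : bounded_measurable (fun z => 1 + h z / M).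
  split; first exact/measurable_EFinP.
  exists 2 => z; rewrite (le_trans (ler_normD _ _))// normr1 -[2]/(1 + 1) lerD2l.
  by rewrite normrM normfV (gtr0_norm Mgt0) ler_pdivrMr// mul1r.
have gi := bounded_measurable_integrable P gb.
have hi := bounded_measurable_integrable P (conj mh (ex_intro _ M hM)).
have mE E : measurable E -> m E = P E.
  move=> mE; apply/esym.
  apply: (@product_measure_unique _ _ _ _ _ mu nu m') => // A B mA mB.
  have mD : measurable (A `*` B) by exact: measurableX.
  have hiD : P.-integrable (A `*` B) (EFin \o h) by exact: integrableS hi.
  have hD0 : (\int[P]_(z in A `*` B) (h z)%:E = 0)%E.
    rewrite integral_mkcond -(fineK (integrable_fin_num _ _)) //; last first.
      exact/(integrable_mkcond _ _).1.
    congr (_%:E); rewrite -[RHS](hAB A B mA mB); congr fine.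
    apply: eq_integral => z _.
    rewrite patchE /= indicE indicE; case: ifPn => [|].
      by rewrite inE => -[/= Az Bz]; rewrite !mem_set// !mul1r.
    rewrite notin_setE /= => nAB; case: (boolP (z.1 \in A)) => zA; last by rewrite !mul0r.
    case: (boolP (z.2 \in B)) => zB; last by rewrite mulr0 mul0r.
    by case: nAB; split; [move: zA|move: zB]; rewrite inE.
  rewrite -(product_measure1E mu nu)//= -[RHS]mul1e -integral_cst//.
  rewrite -[RHS]adde0 -[X in (_ + X)%E](mule0 (M^-1)%:E) -hD0 -integralZl//.
  rewrite -integralD//; last exact: integrableZl.
    by apply: eq_integral => z _; rewrite /g EFinD mulrC EFinM.
  have := bounded_measurable_integrable P b1; exact: integrableS.
have : ae_eq P setT g (cst 1%E).
  apply: integral_ae_eq => // E _ mE'.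
  by rewrite [LHS]mE// integral_cst// mul1e.
apply: filterS => z /= /(_ I) [] /eqP.
rewrite -subr_eq0 addrAC subrr add0r mulf_eq0 invr_eq0 (gt_eqF Mgt0) orbF.
by move/eqP.
Qed.
End rectangles.

(** * Complex integrals *)

Section complex_integral.
Context {R : realType}.

Definition complex_bounded_measurable d (X : measurableType d) (f : X -> R[i]) :=
  complex_measurable f /\ exists M : R, forall x, `|f x| <= M%:C%C.

Definition complex_integral d (X : measurableType d)
    (mu : {measure set X -> \bar R}) (f : X -> R[i]) : R[i] :=
  ((\int[mu]_x Re (f x)) +i* (\int[mu]_x Im (f x)))%C.

Definition complex_integrable d (X : measurableType d)
    (mu : {measure set X -> \bar R}) (f : X -> R[i]) :=
  mu.-integrable setT (fun x => (Re (f x))%:E) /\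
  mu.-integrable setT (fun x => (Im (f x))%:E).

Lemma normc_ge_Im (z : R[i]) : `|Im z|%:C%C <= `|z|.
Proof.
have -> : Im z = Re (z * - 'i%C) by case: z => a b; simpc.
rewrite (le_trans (normc_ge_Re _))// normrM normrN [`|'i%C|]normc_def /=.
by rewrite expr0n/= add0r expr1n sqrtr1 mulr1.
Qed.

Lemma normc_le_ReIm (z : R[i]) : `|z| <= (`|Re z| + `|Im z|)%:C%C.
Proof.
rewrite {1}[z]complexE (le_trans (ler_normD _ _))// normrM.
have nR (r : R) : `|r%:C%C| = `|r|%:C%C.
  by rewrite normc_def /= expr0n/= addr0 sqrtr_sqr.
have -> : `|'i%C| = 1 :> R[i] by rewrite normc_def /= expr0n/= add0r expr1n sqrtr1.
by rewrite mul1r !nR -rmorphD.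
Qed.

Section one_space.
Context d (X : measurableType d).
Implicit Type f g : X -> R[i].

Lemma complex_bounded_measurableP f : complex_bounded_measurable f <->
  bounded_measurable (fun x => Re (f x)) /\ bounded_measurable (fun x => Im (f x)).
Proof.
split=> [[[mR mI] [M hM]]|[[mR [M hM]] [mI [N hN]]]].
  split; split => //; exists M => x; rewrite -lecR.
    exact: le_trans (normc_ge_Re _) (hM x).
  exact: le_trans (normc_ge_Im _) (hM x).
split => //; exists (M + N) => x; rewrite (le_trans (normc_le_ReIm _))// lecR.
exact: lerD.
Qed.

Lemma complex_bounded_measurable_unit f : complex_measurable f ->
  (forall x, `|f x| = 1) -> complex_bounded_measurable f.
Proof. by move=> mf f1; split => //; exists 1 => x; rewrite f1. Qed.

Lemma complex_bounded_measurable_indic (A : set X) : measurable A ->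
  complex_bounded_measurable (fun x => (\1_A x : R)%:C%C).
Proof.
move=> mA; split; first exact: complex_measurable_real (measurable_indic mA).
exists 1 => x; rewrite indicE; case: (_ \in _); by rewrite ?normr1 ?normr0.
Qed.

Lemma complex_bounded_measurable_conj f : complex_bounded_measurable f ->
  complex_bounded_measurable (fun x => (f x)^*%C).
Proof.
move=> [mf [M hM]]; split; first exact: complex_measurable_conj.
by exists M => x; rewrite normcJ.
Qed.

Lemma complex_bounded_measurableM f g : complex_bounded_measurable f ->
  complex_bounded_measurable g -> complex_bounded_measurable (fun x => f x * g x).
Proof.
move=> [mf [M hM]] [mg [N hN]]; split; first exact: complex_measurableM.
by exists (M * N) => x; rewrite normrM rmorphM/= ler_pM.
Qed.

Lemma complex_bounded_measurable_comp d' (Z : measurableType d') (u : Z -> X) f :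
  measurable_fun setT u -> complex_bounded_measurable f ->
  complex_bounded_measurable (fun z => f (u z)).
Proof.
move=> mu [mf [M hM]]; split; last by exists M.
exact: complex_measurable_comp.
Qed.

Variable mu : probability X R.

Lemma EFin_Rintegral (h : X -> R) : bounded_measurable h ->
  (\int[mu]_x (h x)%:E = (\int[mu]_x h x)%:E)%E.
Proof.
move=> bh; rewrite fineK//; apply: integrable_fin_num => //.
exact: bounded_measurable_integrable.
Qed.

Lemma L20_bounded f : complex_bounded_measurable f ->
  complex_integral mu f = 0 -> L20 mu f.
Proof.
move=> bf [iR iI]; have [mf [M hM]] := bf.
have [bR bI] := (complex_bounded_measurableP f).1 bf.
split; last by split; rewrite EFin_Rintegral// ?iR ?iI.
split => //.
have [[mR [A hA]] [mI [B hB]]] := (bR, bI).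
rewrite (EFin_Rintegral (h := fun x => Re (f x) ^+ 2 + Im (f x) ^+ 2)) ?ltry//.
split; first by apply: measurable_funD; exact: measurable_funX.
exists (A ^+ 2 + B ^+ 2) => x; rewrite (le_trans (ler_normD _ _))// !normrX.
by rewrite lerD// lerXn2r// nnegrE// (le_trans _ (hA x), le_trans _ (hB x)).
Qed.

Lemma complex_bounded_measurable_integrable f :
  complex_bounded_measurable f -> complex_integrable mu f.
Proof.
move=> /complex_bounded_measurableP[bR bI].
by split; [exact: (bounded_measurable_integrable mu bR)
          |exact: (bounded_measurable_integrable mu bI)].
Qed.

(** The measure is finite, so 1 + |f|^2 is integrable, and it dominates both components of [f]. *)
Lemma square_integrable_integrable f :
  square_integrable mu f -> complex_integrable mu f.
Proof.
move=> [[mR mI] fi].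
have mn : measurable_fun setT (fun x => Re (f x) ^+ 2 + Im (f x) ^+ 2).
  by apply: measurable_funD; exact: measurable_funX.
have ni : mu.-integrable setT
    (fun x => (1 + (Re (f x) ^+ 2 + Im (f x) ^+ 2))%:E).
  apply: (@integrableD _ _ _ mu setT measurableT (cst 1%E)
    (fun x => (Re (f x) ^+ 2 + Im (f x) ^+ 2)%:E)).
    apply: (@bounded_measurable_integrable _ _ _ mu (cst 1)).
    by split; [exact: measurable_cst|exists 1 => x; rewrite normr1].
  apply/integrableP; split; first exact/measurable_EFinP.
  by under eq_integral => x _ do rewrite gee0_abs ?lee_fin ?addr_ge0 ?sqr_ge0//.
have le1 (a b : R) : `|a| <= 1 + (a ^+ 2 + b ^+ 2).
  have := sqr_ge0 (`|a| - 1); have := sqr_ge0 b; have := sqr_ge0 a.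
  have <- : `|a| ^+ 2 = a ^+ 2 by rewrite real_normK ?num_real.
  by move: `|a| (normr_ge0 a) => {}a; nra.
split.
- apply: le_integrable ni => //; first exact/measurable_EFinP.
  by move=> x _ /=; rewrite lee_fin [leRHS]ger0_norm ?addr_ge0 ?sqr_ge0.
- apply: le_integrable ni => //; first exact/measurable_EFinP.
  move=> x _ /=; rewrite lee_fin [leRHS]ger0_norm ?addr_ge0 ?sqr_ge0//.
  by rewrite (addrC (_ ^+ 2)).
Qed.

Let integrableZr (h : X -> R) c : mu.-integrable setT (fun x => (h x)%:E) ->
  mu.-integrable setT (fun x => (c * h x)%:E).
Proof. by move=> hi; exact: (integrableZl measurableT c hi). Qed.

Lemma complex_integrableZ f (k : R[i]) : complex_integrable mu f ->
  complex_integrable mu (fun x => k * f x).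
Proof.
move=> [iR iI]; case: k => a b; split.
- have := integrableB measurableT (integrableZr a iR) (integrableZr b iI).
  by apply: eq_integrable => // x _; case: (f x).
- have := integrableD measurableT (integrableZr a iI) (integrableZr b iR).
  by apply: eq_integrable => // x _; case: (f x).
Qed.

Lemma complex_integralZ f (k : R[i]) : complex_integrable mu f ->
  complex_integral mu (fun x => k * f x) = k * complex_integral mu f.
Proof.
move=> [iR iI]; case: k => a b.
rewrite /complex_integral; simpc; congr (_ +i* _)%C.
- rewrite -!RintegralZl// -RintegralB//; [|exact: integrableZr|exact: integrableZr].
  by apply: eq_Rintegral => x _; case: (f x).
- rewrite -!RintegralZl// -RintegralD//; [|exact: integrableZr|exact: integrableZr].
  by apply: eq_Rintegral => x _; case: (f x).
Qed.

Lemma eq_ae_complex_integral f g : complex_measurable f -> complex_measurable g ->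
  {ae mu, forall x, f x = g x} -> complex_integral mu f = complex_integral mu g.
Proof.
move=> [fR fI] [gR gI] fg; congr (_ +i* _)%C; apply: eq_ae_Rintegral => //.
- by apply: filterS fg => x ->.
- by apply: filterS fg => x ->.
Qed.

(** Integrability has to be asked separately: a real integral is read off by [fine], which sends an
    infinite value to 0. *)
Lemma complex_integral_norm_eq0 f : complex_measurable f ->
  complex_integral mu (fun x => `|f x|) = 0 ->
  mu.-integrable setT (fun x => (Re `|f x|)%:E) -> {ae mu, forall x, f x = 0}.
Proof.
move=> mf [iR _] fi.
have : (\int[mu]_x `|(Re `|f x|)%:E| = 0)%E.
  under eq_integral => x _.
    rewrite gee0_abs; last by rewrite lee_fin normc_def sqrtr_ge0.
    over.
  by rewrite -(fineK (integrable_fin_num _ fi))// [fine _]iR.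
move/(ae_eq_integral_abs mu measurableT (measurable_int _ fi)).
apply: filterS => x /= /(_ I) [] fx0; apply/eqP; rewrite -normr_eq0.
have -> : `|f x| = (Re `|f x|)%:C%C by rewrite normc_def.
by apply/eqP; exact: (congr1 (real_complex R) fx0).
Qed.

End one_space.

Lemma complex_integral_measure_map d d' (X : measurableType d)
    (Y : measurableType d') (mu : probability X R) (nu : probability Y R)
    (u : X -> Y) (f : Y -> R[i]) :
  measure_map mu nu u -> complex_bounded_measurable f ->
  complex_integral mu (fun x => f (u x)) = complex_integral nu f.
Proof.
move=> hu /complex_bounded_measurableP[bR bI]; congr (_ +i* _)%C.
  exact: (Rintegral_measure_map hu bR).
exact: (Rintegral_measure_map hu bI).
Qed.

Section product.
Context dX dY (X : measurableType dX) (Y : measurableType dY).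
Variables (mu : probability X R) (nu : probability Y R) (F : X * Y -> R[i]).
Hypothesis bF : complex_bounded_measurable F.

Lemma complex_bounded_measurable_integral1 : complex_bounded_measurable
  (fun x => complex_integral nu (fun y => F (x, y))).
Proof.
have [bR bI] := (complex_bounded_measurableP F).1 bF.
apply/complex_bounded_measurableP; split.
  exact: (bounded_measurable_Rintegral1 mu nu bR).
exact: (bounded_measurable_Rintegral1 mu nu bI).
Qed.

Lemma complex_bounded_measurable_integral2 : complex_bounded_measurable
  (fun y => complex_integral mu (fun x => F (x, y))).
Proof.
have [bR bI] := (complex_bounded_measurableP F).1 bF.
apply/complex_bounded_measurableP; split.
  exact: (bounded_measurable_Rintegral2 mu nu bR).
exact: (bounded_measurable_Rintegral2 mu nu bI).
Qed.

Lemma complex_integral_prod1 :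
  complex_integral mu (fun x => complex_integral nu (fun y => F (x, y))) =
  complex_integral (mu \x nu)%E F.
Proof.
have [bR bI] := (complex_bounded_measurableP F).1 bF.
congr (_ +i* _)%C; first exact: (Rintegral_prod1 mu nu bR).
exact: (Rintegral_prod1 mu nu bI).
Qed.

Lemma complex_integral_prod2 :
  complex_integral nu (fun y => complex_integral mu (fun x => F (x, y))) =
  complex_integral (mu \x nu)%E F.
Proof.
have [bR bI] := (complex_bounded_measurableP F).1 bF.
congr (_ +i* _)%C; first exact: (Rintegral_prod2 mu nu bR).
exact: (Rintegral_prod2 mu nu bI).
Qed.

(* [F] integrates to [0] over rectangles, hence over all measurable sets. *)
Lemma complex_partial_integral_eq0 :
  (forall A, measurable A -> {ae nu, forall y,
    complex_integral mu (fun x => (\1_A x : R)%:C%C * F (x, y)) = 0}) ->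
  {ae (mu \x nu)%E, forall z, F z = 0}.
Proof.
move=> FA; have [bR bI] := (complex_bounded_measurableP F).1 bF.
(* The indicator is real, so the hypothesis splits into real and imaginary parts. Integrating the
   inner integral against the indicator of [B] then produces the rectangles. *)
have key (h : X * Y -> R) : bounded_measurable h ->
    (forall A, measurable A -> {ae nu, forall y,
      \int[mu]_x (\1_A x * h (x, y)) = 0}) ->
    {ae (mu \x nu)%E, forall z, h z = 0}.
  move=> bh hA; apply: bounded_rectangle_eq0 => // A B mA mB.
  have [mh [M hM]] := bh.
  have b1 : bounded_measurable (fun z : X * Y => \1_A z.1 * \1_B z.2 * h z).
    split.
      apply: measurable_funM => //; apply: measurable_funM.
        exact: measurableT_comp measurable_fst.
      exact: measurableT_comp measurable_snd.
    exists M => z; rewrite !indicE; case: (_ \in _); case: (_ \in _);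
      by rewrite ?(mul1r,mul0r,normr0) // (le_trans (normr_ge0 _) (hM z)).
  rewrite -(Rintegral_prod2 mu nu b1)/=.
  rewrite -[RHS](mul0r (fine (nu setT))) -Rintegral_cst//.
  apply: eq_ae_Rintegral => //.
    exact: (bounded_measurable_Rintegral2 mu nu b1).1.
  apply: filterS (hA A mA) => y hy.
  transitivity (\1_B y * \int[mu]_x (\1_A x * h (x, y))); last by rewrite hy mulr0.
  rewrite -RintegralZl//; last first.
    apply: bounded_measurable_integrable; split.
      apply: measurable_funM => //; exact: measurableT_comp mh (pair2_measurable y).
    exists M => x; rewrite indicE; case: (_ \in _);
      by rewrite ?(mul1r,mul0r,normr0) // (le_trans (normr_ge0 _) (hM (x, y))).
  by apply: eq_Rintegral => x _; rewrite mulrCA mulrA.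
have FR : {ae (mu \x nu)%E, forall z, Re (F z) = 0}.
  apply: (key _ bR) => A mA; apply: filterS (FA A mA) => y [] + _.
  move=> <-; apply: eq_Rintegral => x _.
  by case: (F (x, y)) => a b /=; rewrite mul0r subr0.
have FI : {ae (mu \x nu)%E, forall z, Im (F z) = 0}.
  apply: (key _ bI) => A mA; apply: filterS (FA A mA) => y [] _.
  move=> <-; apply: eq_Rintegral => x _.
  by case: (F (x, y)) => a b /=; rewrite mul0r addr0.
apply: filterS2 FR FI => z; by case: (F z) => a b /= -> ->.
Qed.

End product.
End complex_integral.

(** * Ergodicity *)

Section ergodicity.
Context {R : realType} {d} {X : measurableType d}.
Variables (mu : probability X R) (T : X -> X).
Hypothesis hT : measure_preserving mu T.

Lemma ae_measure0 (A : set X) : measurable A ->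
  {ae mu, forall x, A x} <-> mu (~` A) = 0%E.
Proof. by move=> mA; apply: (negligibleP mu); exact: measurableC. Qed.

(** Lets almost everywhere identities be evaluated at some common point, which is how equations
    between constants are proved. *)
Lemma not_ae_false : ~ {ae mu, X -> False}.
Proof.
move=> [N [mN N0 XN]]; have := probability_setT mu.
rewrite (_ : setT = N); last by apply/seteqP; split => // x _; apply: XN => /=; exact.
by move/eqP; rewrite N0 eq_sym onee_eq0.
Qed.

Lemma ergodic_ae (A : set X) : ergodic mu T -> measurable A ->
  {ae mu, forall x, A (T x) <-> A x} ->
  {ae mu, forall x, A x} \/ {ae mu, forall x, ~ A x}.
Proof.
move=> eT mA invA; have mTA : measurable (T @^-1` A).
  by rewrite -[_ @^-1` _]setTI; exact: hT.1.
have mD : measurable ((T @^-1` A) `+` A).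
  by apply: measurableU; apply: measurableD.
case: (eT A mA).
- apply: measure_negligible => //; apply: negligibleS invA => x /=.
  by case=> -[+ + ATA]; [move=> /ATA|move=> + /ATA].
- by move=> A0; right; apply/(ae_measure0 (measurableC mA)); rewrite setCK.
- by move/(ae_measure0 mA); left.
Qed.

(** Since [m] never vanishes, the zero set of [f] is invariant. The factor may depend on [x] because
    the lemma serves both for an eigenvalue and for a factor involving [chi (phi x)]. *)
Lemma ergodic_neq0 (f m : X -> R[i]) : ergodic mu T -> complex_measurable f ->
  (forall x, m x != 0) -> {ae mu, forall x, f (T x) = m x * f x} ->
  nonzero mu f -> {ae mu, forall x, f x != 0}.
Proof.
move=> eT mf m0 fT fn0.
have [||f0|] := ergodic_ae (A := [set x | f x = 0]) eT.
- by apply: measurable_eqc => //; exact: complex_measurable_cst.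
- apply: filterS fT => x /= ->; split=> [/eqP|->]; last by rewrite mulr0.
  by rewrite mulf_eq0 (negPf (m0 x)) => /eqP.
- by [].
- by apply: filterS => x /= /eqP.
Qed.

(** One level set suffices, the one below the mean [k]. By ergodicity [h - k] has a constant sign
    almost everywhere, and its integral is 0, so it vanishes almost everywhere. *)
Lemma ergodic_invariant_cst (h : X -> R) : ergodic mu T -> bounded_measurable h ->
  {ae mu, forall x, h (T x) = h x} -> exists k, {ae mu, forall x, h x = k}.
Proof.
move=> eT bh invh; set k := \int[mu]_x h x; exists k.
have bi := bounded_measurable_integrable mu bh.
have le0 (g : X -> R) : bounded_measurable g -> \int[mu]_x g x = 0 ->
    {ae mu, forall x, 0 <= g x} -> {ae mu, forall x, g x = 0}.
  move=> [mg bg] ig g0.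
  have gi := bounded_measurable_integrable mu (conj mg bg).
  have : (\int[mu]_x `|(g x)%:E| = 0)%E.
    transitivity (\int[mu]_x (g x)%:E)%E.
      apply: ae_eq_integral => //; first by apply: measurableT_comp => //; exact/measurable_EFinP.
        exact/measurable_EFinP.
      by apply: filterS g0 => x gx _; rewrite gee0_abs.
    by rewrite -(fineK (integrable_fin_num _ gi))// [fine _]ig.
  move/(ae_eq_integral_abs mu measurableT (measurable_int _ gi)).
  by apply: filterS => x /= /(_ I) [].
have bB (g : X -> R) c : bounded_measurable g -> bounded_measurable (fun x => g x - c).
  move=> [mg [M hM]]; split; first exact: measurable_funB.
  by exists (M + `|c|) => x; rewrite (le_trans (ler_normB _ _))// lerD2r.
have bN (g : X -> R) c : bounded_measurable g -> bounded_measurable (fun x => c - g x).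
  move=> [mg [M hM]]; split; first exact: measurable_funB.
  by exists (`|c| + M) => x; rewrite (le_trans (ler_normB _ _))// lerD2l.
have [mh _] := bh.
have ci c : mu.-integrable setT (EFin \o (fun=> c : R)).
  apply: bounded_measurable_integrable; split; first exact: measurable_cst.
  by exists `|c|.
have kE : \int[mu]_x (fun=> k) x = k.
  by rewrite Rintegral_cst// [X in fine X]probability_setT mulr1.
have iB : \int[mu]_x (h x - k) = 0 by rewrite RintegralB// kE subrr.
have iN : \int[mu]_x (k - h x) = 0 by rewrite RintegralB// kE subrr.
have mlt : measurable [set x | h x < k].
  have := measurable_fun_ltr mh (measurable_cst k) measurableT (Y := [set true]) I.
  by congr measurable; apply/seteqP; split => x /=; [case|].
have [|hk|hk] := ergodic_ae (A := [set x | h x < k]) eT mlt.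
- by apply: filterS invh => x /= ->.
- have := le0 _ (bN _ k bh) iN.
  have /[swap] /[apply] : {ae mu, forall x, 0 <= k - h x}.
    by apply: filterS hk => x /ltW; rewrite subr_ge0.
  by apply: filterS => x /eqP; rewrite subr_eq0 eq_sym => /eqP.
- have := le0 _ (bB _ k bh) iB.
  have /[swap] /[apply] : {ae mu, forall x, 0 <= h x - k}.
    by apply: filterS hk => x /negP; rewrite -leNgt subr_ge0.
  by apply: filterS => x /eqP; rewrite subr_eq0 => /eqP.
Qed.

Lemma ergodic_invariant_unit (u : X -> R[i]) : ergodic mu T ->
  complex_measurable u -> (forall x, `|u x| = 1) ->
  {ae mu, forall x, u (T x) = u x} ->
  exists2 k, `|k| = 1 & {ae mu, forall x, u x = k}.
Proof.
move=> eT [mR mI] u1 uT.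
have [||a ha] := ergodic_invariant_cst (h := fun x => Re (u x)) eT.
- by split => //; exists 1 => x; exact: (norm_ReIm_le1 (u1 x)).1.
- by apply: filterS uT => x ->.
have [||b hb] := ergodic_invariant_cst (h := fun x => Im (u x)) eT.
- by split => //; exists 1 => x; exact: (norm_ReIm_le1 (u1 x)).2.
- by apply: filterS uT => x ->.
have uk : {ae mu, forall x, u x = (a +i* b)%C}.
  by apply: filterS2 ha hb => x <- <-; case: (u x).
exists (a +i* b)%C => //; apply: contrapT => k1; apply: not_ae_false.
by apply: filterS uk => x uxk; case: k1; rewrite -uxk u1.
Qed.

(** An invariant set [A] of measure strictly between 0 and 1 gives the eigenfunction 1_A - mu(A) in
    L^2_0, with eigenvalue 1. *)
Lemma weakly_mixing_ergodic : weakly_mixing mu T -> ergodic mu T.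
Proof.
move=> wT A mA invA; apply: contrapT => /not_orP[A0 nA0]; apply: wT.
pose a := fine (mu A); pose f (x : X) : R[i] := (\1_A x - a)%:C%C.
have Aa : (a%:E = mu A)%E by rewrite fineK// fin_num_measure.
have mh : measurable_fun setT (fun x : X => \1_A x - a : R).
  by apply: measurable_funB => //; exact: measurable_indic.
have b1 : bounded_measurable (\1_A : X -> R).
  split; first exact: measurable_indic.
  by exists 1 => x; rewrite indicE; case: (_ \in _); rewrite ?normr0 ?normr1.
have bc c : bounded_measurable (fun _ : X => c : R).
  by split; [exact: measurable_cst|exists `|c|].
have bf : complex_bounded_measurable f.
  apply/complex_bounded_measurableP; split; last exact: bc.
  split => //; exists (1 + `|a|) => x; rewrite (le_trans (ler_normB _ _))// lerD2r.
  by rewrite indicE; case: (_ \in _); rewrite ?normr0 ?normr1.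
exists 1, f; split.
- apply: L20_bounded => //; rewrite /complex_integral /=; congr (_ +i* _)%C.
    rewrite RintegralB//; try exact: bounded_measurable_integrable.
    rewrite Rintegral_cst// [X in fine X]probability_setT mulr1.
    by rewrite /Rintegral integral_indic// setIT subrr.
  by rewrite Rintegral_cst// mul0r.
- have [a0 a1] : a != 0 /\ a != 1.
    split; apply/eqP => aE; first by apply: A0; rewrite [LHS](esym Aa) aE.
    have A1 : mu A = 1%E by rewrite [LHS](esym Aa) aE.
    by apply: nA0; rewrite [LHS]probability_setC// [X in (1 - X)%E]A1 subee.
  move=> f0; apply: (@not_ae_false); apply: filterS f0 => x [] /eqP.
  rewrite subr_eq0 indicE; case: (_ \in _) => /eqP E.
    by rewrite -E eqxx in a1.
  by rewrite -E eqxx in a0.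
- exists ((T @^-1` A) `+` A); split => //.
    apply: measurableU; apply: measurableD => //;
      rewrite -[_ @^-1` _]setTI; exact: hT.1.
  move=> x /= nf; apply: contrapT => nx; apply: nf; rewrite mul1r /f; congr ((_ - _)%:C%C).
  rewrite !indicE; case: (boolP (x \in A)); case: (boolP (T x \in A)) => //.
    by rewrite notin_setE inE => ? ?; case: nx; right.
  by rewrite notin_setE inE => ? ?; case: nx; left.
Qed.

End ergodicity.

(** * Eigenfunctions of the action and of the skew product *)

Lemma negligible_bigcup_count {R : realType} d (X : measurableType d)
    (mu : {measure set X -> \bar R}) (I : countType) (F : I -> set X) :
  (forall i, mu.-negligible (F i)) -> mu.-negligible (\bigcup_i F i).
Proof.
move=> F0; pose N n := if unpickle n is Some i then F i else set0.
apply: (negligibleS (A := \bigcup_n N n)) => [x [i _ Fix]|].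
  by exists (pickle i) => //; rewrite /N pickleK.
apply: negligible_bigcup => n; rewrite /N; case: unpickle => [i|] //.
exact: negligible_set0.
Qed.

Section eigencharacter.
Context {R : realType} {G : topologicalZmodType} {d} {Y : measurableType d}.
Variables (nu : probability Y R) (S : G -> Y -> Y).
Hypothesis hS : group_action nu S.

Lemma measurable_action g (B : set Y) : measurable B -> measurable (S g @^-1` B).
Proof.
by move=> mB; rewrite -[_ @^-1` _]setTI; have [/(_ g)[[mSg _] _] _ _] := hS; exact: mSg.
Qed.

Lemma borel_group_action_gt0 (A B : set Y) : measurable A -> measurable B ->
  borel [set g : G | (0 < nu (A `&` S g @^-1` B))%E].
Proof.
move=> mA mB; have [_ _ bS] := hS.
have [_ bC bU] := smallest_sigma_algebra [set: G] (@open G).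
rewrite (_ : [set g | _] = \bigcup_n ([set: G] `\`
    [set g | (nu (A `&` S g @^-1` B) < (n.+1%:R^-1)%:E)%E])).
  by apply: bU => n; apply: bC; exact: bS.
apply/seteqP; split => g /=; last first.
  by move=> [n _ [_ /= /negP]]; rewrite -leNgt => h; apply: lt_le_trans h; rewrite lte_fin.
have fn : nu (A `&` S g @^-1` B) \is a fin_num.
  by apply: fin_num_measure; apply: measurableI => //; exact: measurable_action.
rewrite -(fineK fn) lte_fin; set r := fine _ => r0.
(* With [n] the integer part of 1/r, the threshold 1/(n+1) is at most [r]. *)
exists (Num.truncn r^-1) => //; split => //=; apply/negP; rewrite -leNgt -(fineK fn) lee_fin.
by rewrite invf_ple ?posrE//; exact/ltW/truncnS_gt.
Qed.

Lemma eigencharacter_continuous (chi : G -> R[i]) (f : Y -> R[i]) :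
  hausdorff_space G -> locally_compact [set: G] ->
  (forall g, `|chi g| = 1) -> (forall g h, chi (g + h) = chi g * chi h) ->
  complex_measurable f -> (forall y, `|f y| = 1) ->
  (forall g, {ae nu, forall y, f (S g y) = chi g * f y}) ->
  continuous (chi : G -> R[i]^o).
Proof.
move=> hG lcG chi1 chiD mf f1 fS; apply: borel_hom_continuous => // e e0.
have [r r0 er] : exists2 r : R, 0 < r & e = r%:C%C.
  case: e e0 => a b; rewrite ltcE /= => /andP[/eqP -> a0]; by exists a.
(* A cell has side 1/K in each component, hence diameter at most 2/K; two cells enter the estimate,
   and 4/K = r/2 < r. *)
pose K := 8 / r; have K0 : 0 < K by rewrite divr_gt0.
(* [f] varies by at most [2 / K] on each [B], and [chi g] is the ratio of the
   values of [f] at [S g y] and at [y]. *)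
pose B (p : int * int) := [set y | Num.floor (K * Re (f y)) = p.1] `&`
  [set y | Num.floor (K * Im (f y)) = p.2].
have mfl (h : Y -> R) (a : int) : measurable_fun setT h ->
    measurable [set y | Num.floor (K * h y) = a].
  move=> mh; have mKh : measurable_fun setT (fun y => K * h y).
    exact: measurable_funM.
  have := mKh measurableT `[a%:~R, (a + 1)%:~R[%classic (measurable_itv _).
  congr measurable; apply/seteqP; split => y /=; rewrite in_itv/=.
    by case=> _ /floor_def.
  by move=> <-; split => //; rewrite floor_le floorD1_gt.
have mB p : measurable (B p).
  by case: mf => mR mI; apply: measurableI; exact: mfl.
have Bclose p y y' : B p y -> B p y' -> `|f y - f y'| <= (2 / K)%:C%C.
  have fl (a b : R) : Num.floor (K * a) = Num.floor (K * b) -> `|a - b| <= K^-1.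
    move=> ab; have := floor_le (K * a); have := floorD1_gt (K * a).
    have := floor_le (K * b); have := floorD1_gt (K * b).
    rewrite ab intrD => h1 h2 h3 h4.
    rewrite -(ler_pM2l K0) mulfV ?gt_eqF// -{1}(gtr0_norm K0) -normrM mulrBr.
    by rewrite ler_norml; lra.
  move=> [/= R1 I1] [/= R2 I2]; rewrite (le_trans (normc_le_ReIm _))// lecR.
  have -> : 2 / K = K^-1 + K^-1 by rewrite mulr_natl mulr2n.
  have -> : Re (f y - f y') = Re (f y) - Re (f y') by case: (f y) (f y') => ? ? [].
  have -> : Im (f y - f y') = Im (f y) - Im (f y') by case: (f y) (f y') => ? ? [].
  by apply: lerD; apply: fl; rewrite ?R1 ?R2 ?I1 ?I2.
pose E (q : (int * int) * (int * int)) g := B q.1 `&` S g @^-1` B q.2.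
have mE q g : measurable (E q g).
  by apply: measurableI => //; exact: measurable_action.
exists (fun q => [set g | (0 < nu (E q g))%E]); split.
- by move=> q; exact: borel_group_action_gt0.
(* For fixed [g] the countably many sets [E q g] cover [Y], so they cannot all be null. *)
- apply/seteqP; split => // g _; apply: contrapT => nA.
  have E0 q : nu.-negligible (E q g).
    apply/negligibleP => //; apply/eqP; rewrite eq_le measure_ge0 andbT leNgt.
    by apply/negP => Eq0; apply: nA; exists q.
  apply: (@not_ae_false _ _ _ nu).
  apply: negligibleS (negligible_bigcup_count E0) => y _.
  by exists ((Num.floor (K * Re (f y)), Num.floor (K * Im (f y))),
    (Num.floor (K * Re (f (S g y))), Num.floor (K * Im (f (S g y))))).
- move=> q g h /= Eg Eh.
  (* Positive measure leaves a point of the cell outside the null set where the eigenfunction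
     equation for this group element fails. *)
  have pick g' : (0 < nu (E q g'))%E ->
      exists y, E q g' y /\ f (S g' y) = chi g' * f y.
    move=> Eg0; apply: contrapT => nE.
    have [N [mN N0 fN]] := fS g'.
    move: Eg0; rewrite ltNge -N0 => /negP; apply; apply: le_measure => //.
    - exact/mem_set/mE.
    - exact/mem_set.
    - by move=> y Ey; apply: fN => /= fy; apply: nE; exists y.
  have [y [[By BSy] fy]] := pick g Eg; have [z [[Bz BSz] fz]] := pick h Eh.
  have : `|chi g - chi h| <= (2 / K)%:C%C + (2 / K)%:C%C.
    (* The right side is the modulus of (chi g - chi h) f(y), and [f y] has modulus 1. *)
    have -> : `|chi g - chi h| = `|(f (S g y) - f (S h z)) - chi h * (f y - f z)|.
      rewrite fy fz -[LHS]mulr1 -(f1 y) -normrM; congr (`|_|); ring.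
    rewrite (le_trans (ler_normB _ _))// normrM chi1 mul1r.
    by apply: lerD; [exact: (Bclose _ _ _ BSy BSz)|exact: (Bclose _ _ _ By Bz)].
  move=> /le_lt_trans; apply; rewrite er -rmorphD ltcR /K invf_div.
  by lra.
Qed.

End eigencharacter.

Section transport.
Context {R : realType} d d' (X : measurableType d) (Y : measurableType d').
Variables (mu : probability X R) (nu : probability Y R) (u : X -> Y).
Hypothesis hu : measure_map mu nu u.

Lemma measure_map_aeP (A : set Y) : measurable A ->
  {ae mu, forall x, A (u x)} -> {ae nu, forall y, A y}.
Proof.
move=> mA Au; apply/(ae_measure0 nu mA).
rewrite -hu.2; last exact: measurableC.
apply: (measure_negligible (mu := mu)); last exact: Au.
by rewrite -[_ @^-1` _]setTI; apply: hu.1 => //; exact: measurableC.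
Qed.

Lemma L20_measure_map (f : Y -> R[i]) : L20 nu f -> L20 mu (fun x => f (u x)).
Proof.
move=> [sf [fR fI]]; have [[mR mI] fi] := sf.
have mn : measurable_fun setT (fun y => (Re (f y) ^+ 2 + Im (f y) ^+ 2)%:E).
  apply/measurable_EFinP.
  by apply: measurable_funD; exact: measurable_funX.
have sfu : square_integrable mu (fun x => f (u x)).
  split; first exact: complex_measurable_comp hu.1 sf.1.
  by rewrite (ge0_integral_measure_map hu mn)// => y; rewrite lee_fin addr_ge0 ?sqr_ge0.
have [iR iI] := square_integrable_integrable sfu.
split=> //; split; [rewrite -fR|rewrite -fI].
- by apply: (integral_measure_map hu (f := fun y => (Re (f y))%:E)) => //;
    exact/measurable_EFinP.
- by apply: (integral_measure_map hu (f := fun y => (Im (f y))%:E)) => //;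
    exact/measurable_EFinP.
Qed.

Lemma nonzero_measure_map (f : Y -> R[i]) : complex_measurable f ->
  nonzero nu f -> nonzero mu (fun x => f (u x)).
Proof.
move=> mf f0 fu0; apply: f0; apply: (measure_map_aeP (A := [set y | f y = 0])) => //.
exact: measurable_eqc mf (complex_measurable_cst 0).
Qed.

End transport.

Section rokhlin.
Context {R : realType} {dX dY} {X : measurableType dX} {Y : measurableType dY}.
Variables (mu : probability X R) (nu : probability Y R).
Variables (G : topologicalZmodType) (T : X -> X) (phi : X -> G) (S : G -> Y -> Y).
Hypotheses (hT : measure_preserving mu T) (hS : group_action nu S).
Hypothesis hTS : measurable_fun [set: X * Y] (skew_product T phi S).

Let P : probability (X * Y)%type R := (mu \x nu)%E.
Let W := skew_product T phi S.

Let hSg g : measure_map nu nu (S g).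
Proof. by have [/(_ g)[]] := hS. Qed.

Lemma measure_map_skew_product : measure_map P P W.
Proof. exact: (measure_map_skew (V := fun x => S (phi x)) hTS hT). Qed.

Let hW := measure_map_skew_product.

Lemma weakly_mixing_base : weakly_mixing P W -> weakly_mixing mu T.
Proof.
move=> wW [c [f [f2 f0 fT]]]; apply: wW; exists c, (fun z => f z.1); split.
- exact: (L20_measure_map (measure_map_fst mu nu) f2).
- exact: (nonzero_measure_map (measure_map_fst mu nu) f2.1.1 f0).
- exact: (measure_map_ae (measure_map_fst mu nu) fT).
Qed.

(** The function xi(x) g(y) has zero mean on each fibre because [g] does, whatever [xi] is. As [g]
    is only square integrable, Fubini is used for integrable rather than bounded functions. *)
Lemma weakly_mixing_no_eigenvalue (chi : G -> R[i]) : weakly_mixing P W ->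
  Sigma_cocycle mu T phi chi -> ~ action_eigenvalue nu S chi.
Proof.
move=> wW [_ [c [xi [c1 mxi xi1 xiE]]]] [g [g2 g0 gS]].
have [[mg gi] [gR gI]] := g2; have [iR iI] := square_integrable_integrable g2.1.
pose F (z : X * Y) := xi z.1 * g z.2.
have mF : complex_measurable F.
  by apply: complex_measurableM; exact: complex_measurable_comp.
have sF : square_integrable P F.
  split=> //; have [[_ +] _] := L20_measure_map (measure_map_snd mu nu) g2.
  apply: le_lt_trans; rewrite le_eqVlt; apply/orP; left; apply/eqP.
  apply: eq_integral => z _; congr EFin; apply: complexI.
  by rewrite !add_Re2_Im2 /F normrM xi1 mul1r.
have [FR FI] := square_integrable_integrable sF.
have intF0 x : complex_integral nu (fun y => F (x, y)) = 0.
  rewrite /F /= complex_integralZ//.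
  by rewrite /complex_integral /Rintegral gR gI mulr0.
have Fx_int x : complex_integrable nu (fun y => F (x, y)).
  exact: (complex_integrableZ (xi x) (conj iR iI)).
apply: wW; exists c, F; split.
- split=> //; split.
  + rewrite -(integral12_prod_meas1 FR); apply: integral0_eq => x _.
    rewrite /fubini_F -[LHS]fineK; last exact: integrable_fin_num (Fx_int x).1.
    by congr EFin; have [] := intF0 x.
  + rewrite -(integral12_prod_meas1 FI); apply: integral0_eq => x _.
    rewrite /fubini_F -[LHS]fineK; last exact: integrable_fin_num (Fx_int x).2.
    by congr EFin; have [] := intF0 x.
- move=> F0; apply: (nonzero_measure_map (measure_map_snd mu nu) mg g0).
  apply: filterS F0 => z /eqP; rewrite mulf_eq0 -normr_eq0 xi1 oner_eq0/=.
  by move/eqP.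
- apply: product_ae.
    apply: measurable_eqc; first exact: complex_measurable_comp mF.
    by apply: complex_measurableM => //; exact: complex_measurable_cst.
  apply: filterS xiE => x xiE; apply: filterS (gS (phi x)) => y gSy.
  rewrite /F /= gSy xiE.
  have xT : xi (T x) != 0 by rewrite -normr_eq0 xi1 oner_eq0.
  by field.
Qed.

Let fiber g (z : X * Y) := (z.1, S g z.2).

Let measurable_fiber g : measurable_fun setT (fiber g).
Proof.
apply/measurable_fun_pair; first exact: measurable_fst.
exact: measurableT_comp (hSg g).1 measurable_snd.
Qed.

Let hfiber g : measure_map P P (fiber g).
Proof.
apply: (measure_map_skew (T := id) (V := fun=> S g)) => //.
exact: measurable_fiber.
Qed.

(** Commutativity of [G] enters here. The identity is stated through [F] because the set where two
    complex measurable functions agree is measurable, as [product_ae] requires, whereas the diagonal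
    of a general measurable space need not be. *)
Let fiber_comm g (F : X * Y -> R[i]) : complex_measurable F ->
  {ae P, forall z, F (fiber g (W z)) = F (W (fiber g z))}.
Proof.
move=> mF; have mG := measurable_fiber g.
apply: product_ae.
  apply: measurable_eqc.
    exact: (complex_measurable_comp (measurableT_comp mG hTS) mF).
  exact: (complex_measurable_comp (measurableT_comp hTS mG) mF).
apply: aeW => x; have [_ SD _] := hS.
apply: filterS2 (SD g (phi x)) (SD (phi x) g) => y E1 E2.
by rewrite /W /fiber /skew_product /= -E1 -E2 addrC.
Qed.

Lemma eigenfunction_character (c : R[i]) (F : X * Y -> R[i]) : ergodic P W ->
  complex_measurable F -> (forall z, `|F z| = 1) -> `|c| = 1 ->
  {ae P, forall z, F (W z) = c * F z} ->
  exists chi : G -> R[i], [/\ forall g, `|chi g| = 1,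
    forall g h, chi (g + h) = chi g * chi h
    & forall g, {ae P, forall z, F (z.1, S g z.2) = chi g * F z}].
Proof.
move=> eW mF F1 c1 FW.
have FJ z : F z * (F z)^*%C = 1 by rewrite -sqr_normc F1 expr1n.
have /choice[chi chiP] g : exists k, `|k| = 1 /\
    {ae P, forall z, F (fiber g z) = k * F z}.
  have mFg : complex_measurable (fun z => F (fiber g z)).
    exact: complex_measurable_comp (measurable_fiber g) mF.
  (* Passing from [z] to [W z] multiplies this ratio by c times its conjugate, which is 1. *)
  have [|||k k1 uk] := ergodic_invariant_unit hW
      (u := fun z => F (fiber g z) * (F z)^*%C) eW.
  - by apply: complex_measurableM => //; exact: complex_measurable_conj.
  - by move=> z; rewrite normrM normcJ !F1 mulr1.
  - have FWg := measure_map_ae (hfiber g) FW.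
    apply: filterS3 (fiber_comm g mF) FW FWg => z -> -> ->.
    rewrite rmorphM/= mulrACA.
    by rewrite -sqr_normc c1 expr1n mul1r.
  - exists k; split => //; apply: filterS uk => z <-.
    by rewrite mulrAC -mulrA FJ mulr1.
exists chi; split=> [g|g h|g]; [exact: (chiP g).1| |exact: (chiP g).2].
have [_ SD _] := hS.
have FD : {ae P, forall z, F (fiber (g + h) z) = F (fiber g (fiber h z))}.
  apply: product_ae.
    apply: measurable_eqc; apply: complex_measurable_comp mF => //.
    exact: measurableT_comp (measurable_fiber g) (measurable_fiber h).
  apply: aeW => x; apply: filterS (SD g h) => y E.
  by rewrite /fiber /= E.
(* The equation for [g] is needed at [fiber h z]; as [fiber h] preserves the measure, the
   exceptional set stays null. *)
have Fgh := measure_map_ae (hfiber h) (chiP g).2.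
apply: contrapT => nE; apply: (@not_ae_false _ _ _ P).
apply: filterS3 FD (filterI Fgh (chiP h).2) (chiP (g + h)).2 => z E1 [E2 E3] E4.
apply: nE; have : chi (g + h) * F z = chi g * chi h * F z.
  by rewrite -E4 E1 E2 E3 mulrA.
move=> /(congr1 (fun w => w * (F z)^*%C)).
by rewrite -!mulrA FJ !mulr1.
Qed.

(** The integrals [f0] and [xi0] satisfy the required equations but might vanish. Ergodicity of [W]
    excludes zeros of [f0], ergodicity of [T] those of [xi0], and both can then be normalised to
    modulus 1. *)
Lemma eigenfunction_cocycle (c : R[i]) (F : X * Y -> R[i]) (chi : G -> R[i]) :
  ergodic P W -> ergodic mu T ->
  complex_measurable F -> (forall z, `|F z| = 1) -> `|c| = 1 ->
  {ae P, forall z, F (W z) = c * F z} ->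
  (forall g, `|chi g| = 1) ->
  (forall g, {ae P, forall z, F (z.1, S g z.2) = chi g * F z}) ->
  exists (f : Y -> R[i]) (xi : X -> R[i]),
    [/\ complex_measurable f, forall y, `|f y| = 1,
        forall g, {ae nu, forall y, f (S g y) = chi g * f y}
      & [/\ complex_measurable xi, forall x, `|xi x| = 1
        & {ae mu, forall x, chi (phi x) * xi (T x) = c * xi x}]].
Proof.
move=> eW eT mF F1 c1 FW chi1 Fchi.
have chi0 g : chi g != 0 by rewrite -normr_eq0 chi1 oner_eq0.
have bF := complex_bounded_measurable_unit mF F1.
(* If the integrals over every [A] vanished, [F] would be 0 almost everywhere, against its modulus
   1. *)
have [A mA fA0] : exists2 A, measurable A & ~ {ae nu, forall y,
    complex_integral mu (fun x => (\1_A x : R)%:C%C * F (x, y)) = 0}.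
  apply: contrapT => nA; apply: (@not_ae_false _ _ _ P).
  have := @complex_partial_integral_eq0 _ _ _ _ _ mu nu F bF.
  have FA A : measurable A -> {ae nu, forall y,
      complex_integral mu (fun x => (\1_A x : R)%:C%C * F (x, y)) = 0}.
    by move=> mA; apply: contrapT => fA0; apply: nA; exists A.
  move=> /(_ FA); apply: filterS => z Fz0; move: (F1 z).
  by rewrite Fz0 normr0 => /eqP; rewrite eq_sym oner_eq0.
pose FA (z : X * Y) := (\1_A z.1 : R)%:C%C * F z.
have bFA : complex_bounded_measurable FA.
  apply: complex_bounded_measurableM => //.
  exact: (complex_bounded_measurable_comp measurable_fst
    (complex_bounded_measurable_indic mA)).
pose f0 y := complex_integral mu (fun x => FA (x, y)).
have bf0 : complex_bounded_measurable f0.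
  exact: (complex_bounded_measurable_integral2 mu nu bFA).
have bFAy y : complex_bounded_measurable (fun x => FA (x, y)).
  exact: complex_bounded_measurable_comp (pair2_measurable y) bFA.
have f0S g : {ae nu, forall y, f0 (S g y) = chi g * f0 y}.
  apply: filterS (ae_product2 (Fchi g)) => y Fy.
  rewrite /f0 -complex_integralZ; last exact: complex_bounded_measurable_integrable.
  apply: eq_ae_complex_integral.
  - exact: (bFAy _).1.
  - apply: complex_measurableM; first exact: complex_measurable_cst.
    exact: (bFAy _).1.
  - by apply: filterS Fy => x /= E; rewrite /FA /= E mulrCA.
have mf00 : measurable [set y | f0 y = 0].
  by apply: measurable_eqc; [exact: bf0.1|exact: complex_measurable_cst].
(* Ergodicity is at hand on the product, so the zero set of [f0] is pulled back along the second
   projection, where it is invariant under [W]. *)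
have f0n0 : {ae nu, forall y, f0 y <> 0}.
  pose Z := [set z : X * Y | f0 z.2 = 0].
  have mZ : measurable Z.
    by have := @measurable_snd _ _ X Y measurableT _ mf00; rewrite setTI.
  have mWZ : measurable (W @^-1` Z) by rewrite -[_ @^-1` _]setTI; exact: hTS.
  have hsnd := measure_map_snd mu nu.
  have [|Z1|Z0] := ergodic_ae hW eW mZ.
  - apply: product_ae.
      have := measurableU _ _ (measurableI _ _ mWZ mZ)
        (measurableI _ _ (measurableC mWZ) (measurableC mZ)).
      congr measurable; apply/seteqP; split => z /=; first by tauto.
      by case: (pselect (Z z)) => Zz [+ +]; [left|right]; tauto.
    apply: aeW => x; apply: filterS (f0S (phi x)) => y E.
    rewrite /Z /W /skew_product /= E; split=> [/eqP|->]; last by rewrite mulr0.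
    by rewrite mulf_eq0 (negPf (chi0 _)) => /eqP.
  - by case: fA0; exact: (measure_map_aeP hsnd mf00).
  - exact: (measure_map_aeP hsnd (measurableC mf00)).
pose f y := unitize (f0 y).
have mf : complex_measurable f := complex_measurable_unitize bf0.1.
have f1 y : `|f y| = 1 := norm_unitize _.
have fS g : {ae nu, forall y, f (S g y) = chi g * f y}.
  apply: filterS2 (f0S g) f0n0 => y E /eqP y0.
  by rewrite /f E unitizeM// (unitize_id (chi1 g)).
pose H (z : X * Y) := F z * (f z.2)^*%C.
have bH : complex_bounded_measurable H.
  apply: complex_bounded_measurableM => //; apply: complex_bounded_measurable_conj.
  apply: (complex_bounded_measurable_comp measurable_snd).
  exact: complex_bounded_measurable_unit.
have bHx x : complex_bounded_measurable (fun y => H (x, y)).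
  exact: complex_bounded_measurable_comp (pair1_measurable x) bH.
pose xi0 x := complex_integral nu (fun y => H (x, y)).
have bxi0 : complex_bounded_measurable xi0.
  exact: (complex_bounded_measurable_integral1 mu nu bH).
(* Along [W], [F] contributes [c] and the conjugate of [f] contributes the conjugate of
   [chi (phi x)]. *)
pose m x := c * (chi (phi x))^*%C.
have m1 x : `|m x| = 1 by rewrite normrM normcJ c1 chi1 mulr1.
have m0 x : m x != 0 by rewrite -normr_eq0 m1 oner_eq0.
have xi0T : {ae mu, forall x, xi0 (T x) = m x * xi0 x}.
  apply: filterS (ae_product1 FW) => x Fx.
  (* no-op *)
  rewrite /xi0 -complex_integralZ; last exact: complex_bounded_measurable_integrable.
  rewrite -(complex_integral_measure_map (hSg (phi x)) (bHx _)).
  apply: eq_ae_complex_integral.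
  - exact: (complex_measurable_comp (hSg (phi x)).1 (bHx (T x)).1).
  - apply: complex_measurableM; first exact: complex_measurable_cst.
    exact: (bHx _).1.
  - apply: filterS2 Fx (fS (phi x)) => y E1 E2.
    rewrite /H /m /= E2 rmorphM/=.
    by move: E1; rewrite /W /skew_product /= => ->; rewrite mulrACA.
have xi0n0 : nonzero mu xi0.
  move=> xi00; apply: fA0.
  have intf0 : complex_integral nu (fun y => `|f0 y|) = 0.
    transitivity (complex_integral nu (fun y =>
        complex_integral mu (fun x => (\1_A x : R)%:C%C * H (x, y)))).
      congr complex_integral; apply/funext => y.
      rewrite -conj_unitizeM -complex_integralZ; last exact: complex_bounded_measurable_integrable.
      by congr complex_integral; apply/funext => x; rewrite /FA /H /= mulrC -mulrA.
    pose HA (z : X * Y) := (\1_A z.1 : R)%:C%C * H z.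
    have bHA : complex_bounded_measurable HA.
      apply: complex_bounded_measurableM => //.
      exact: (complex_bounded_measurable_comp measurable_fst
        (complex_bounded_measurable_indic mA)).
    rewrite (complex_integral_prod2 mu nu bHA) -(complex_integral_prod1 mu nu bHA).
    rewrite -[RHS](mul0r (complex_integral mu (fun=> 0))) -complex_integralZ; last first.
      by apply: complex_bounded_measurable_integrable; split;
        [exact: complex_measurable_cst|exists 0 => x; rewrite normr0].
    apply: eq_ae_complex_integral.
    - exact: (complex_bounded_measurable_integral1 mu nu bHA).1.
    - exact: complex_measurable_cst.
    - apply: filterS xi00 => x E; rewrite mulr0 /HA /= complex_integralZ.
        by rewrite [X in _ * X]E mulr0.
      exact: complex_bounded_measurable_integrable.
  apply: (complex_integral_norm_eq0 bf0.1 intf0).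
  have bnf0 : complex_bounded_measurable (fun y => `|f0 y|).
    rewrite (_ : (fun y => _) = fun y => (f y)^*%C * f0 y).
      apply: complex_bounded_measurableM => //; apply: complex_bounded_measurable_conj.
      exact: complex_bounded_measurable_unit.
    by apply/funext => y; rewrite conj_unitizeM.
  exact: (complex_bounded_measurable_integrable nu bnf0).1.
have xi0ae := ergodic_neq0 hT eT bxi0.1 m0 xi0T xi0n0.
exists f, (fun x => unitize (xi0 x)); split => //; split.
- exact: complex_measurable_unitize bxi0.1.
- by move=> x; exact: norm_unitize.
- apply: filterS2 xi0T xi0ae => x -> x0.
  rewrite unitizeM// (unitize_id (m1 x)) /m mulrA mulrCA -sqr_normc chi1.
  by rewrite expr1n mulr1.
Qed.

End rokhlin.

Lemma unit_eigenfunction (R : realType) d (Z : measurableType d) (P : probability Z R)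
    (W : Z -> Z) (c : R[i]) (f : Z -> R[i]) :
  measure_preserving P W -> ergodic P W ->
  L20 P f -> nonzero P f -> {ae P, forall z, f (W z) = c * f z} ->
  exists (b : R[i]) (F : Z -> R[i]), [/\ `|b| = 1, b != 1, complex_measurable F,
    forall z, `|F z| = 1 & {ae P, forall z, F (W z) = b * F z}].
Proof.
move=> hW eW [sf [fR fI]] f0 fW; have mf := sf.1.
have m0 : measurable [set z | f z = 0].
  by apply: measurable_eqc => //; exact: complex_measurable_cst.
have c0 : c != 0.
  apply/eqP => c0; apply: f0; apply: (measure_map_aeP hW m0).
  by apply: filterS fW => z /= ->; rewrite c0 mul0r.
have fn0 := ergodic_neq0 hW eW mf (fun=> c0) fW f0.
pose F z := unitize (f z).
have mF : complex_measurable F := complex_measurable_unitize mf.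
have FW : {ae P, forall z, F (W z) = unitize c * F z}.
  by apply: filterS2 fW fn0 => z E z0; rewrite /F E unitizeM.
exists (unitize c), F; split => //; last 1 first.
- by move=> z; exact: norm_unitize.
- exact: norm_unitize.
apply/eqP => c1; apply: f0.
have [|k k1 Fk] := ergodic_invariant_unit hW eW mF (fun=> norm_unitize _).
  by apply: filterS FW => z ->; rewrite c1 mul1r.
have fi := square_integrable_integrable sf.
have kf := complex_integrableZ (k^*%C) fi.
have mkf : complex_measurable (fun z => k^*%C * f z).
  by apply: complex_measurableM => //; exact: complex_measurable_cst.
have kfE : {ae P, forall z, k^*%C * f z = `|f z|}.
  by apply: filterS Fk => z Fz; rewrite -conj_unitizeM -Fz.
have mnf : complex_measurable (fun z => `|f z|).
  rewrite (_ : (fun z => _) = fun z => (F z)^*%C * f z); last first.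
    by apply/funext => z; rewrite conj_unitizeM.
  by apply: complex_measurableM => //; exact: complex_measurable_conj.
apply: (complex_integral_norm_eq0 (mu := P) mf).
  rewrite -(eq_ae_complex_integral mkf mnf kfE) complex_integralZ//.
  by rewrite /complex_integral /Rintegral fR fI mulr0.
suff /square_integrable_integrable[] : square_integrable P (fun z => `|f z|) by [].
split => //; case: sf => _; apply: le_lt_trans; rewrite le_eqVlt; apply/orP; left.
apply/eqP; apply: eq_integral => z _; congr EFin; apply: complexI.
by rewrite !add_Re2_Im2 normr_id.
Qed.


Lemma unit_eigenfunction_L20 (R : realType) d (Z : measurableType d)
    (P : probability Z R) (V : Z -> Z) (h : Z -> R[i]) (k : R[i]) :
  measure_preserving P V -> complex_measurable h -> (forall z, `|h z| = 1) ->
  k != 1 -> {ae P, forall z, h (V z) = k * h z} -> L20 P h /\ nonzero P h.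
Proof.
move=> hV mh h1 k1 hk; have bh := complex_bounded_measurable_unit mh h1.
split.
  apply: L20_bounded => //; apply/eqP.
  have E : complex_integral P h = k * complex_integral P h.
    rewrite -complex_integralZ; last exact: complex_bounded_measurable_integrable.
    rewrite -[LHS](complex_integral_measure_map hV bh).
    apply: eq_ae_complex_integral => //.
      exact: complex_measurable_comp hV.1 mh.
    by apply: complex_measurableM => //; exact: complex_measurable_cst.
  have : (1 - k) * complex_integral P h == 0 by rewrite mulrBl mul1r -E subrr.
  by rewrite mulf_eq0 subr_eq0 eq_sym (negPf k1).
move=> h0; apply: (@not_ae_false _ _ _ P); apply: filterS h0 => z hz.
by move: (h1 z); rewrite hz normr0 => /eqP; rewrite eq_sym oner_eq0.
Qed.

Theorem corollary3 (R : realType)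
    (dX dY : measure_display)
    (X : measurableType dX) (mu : probability X R)
    (Y : measurableType dY) (nu : probability Y R)
    (G : topologicalZmodType)
    (T : X -> X) (phi : X -> G) (S : G -> Y -> Y)
    (hX : standard_borel R X) (hY : standard_borel R Y)
    (hGhaus : hausdorff_space G)
    (hGlc : locally_compact [set: G])
    (hGsc : @second_countable G)
    (hT : automorphism mu T)
    (hphi : borel_measurable phi)
    (hS : group_action nu S)
    (hTS : measurable_fun [set: X * Y] (skew_product T phi S)) :
  weakly_mixing (mu \x nu)%E (skew_product T phi S) <->
  [/\ ergodic (mu \x nu)%E (skew_product T phi S),
      weakly_mixing mu T
    & ~ exists chi : G -> R[i],
        Sigma_cocycle mu T phi chi /\ action_eigenvalue nu S chi].
Proof.
have hT1 := hT.1; have hW := measure_map_skew_product hT1 hS hTS.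
split=> [wW|[eW wT noeig]].
  split.
  - exact: (weakly_mixing_ergodic hW wW).
  - exact: (weakly_mixing_base wW).
  - move=> [chi [chiS chiE]].
    exact: (weakly_mixing_no_eigenvalue hTS wW chiS chiE).
move=> [c [f [f2 f0 fW]]].
have [b [F [b1 bn1 mF F1 FW]]] := unit_eigenfunction hW eW f2 f0 fW.
have [chi [chi1 chiD Fchi]] :=
  eigenfunction_character hT1 hS hTS eW mF F1 b1 FW.
have eT := weakly_mixing_ergodic hT1 wT.
have [g [xi [mg g1 gS [mxi xi1 xiT]]]] :=
  eigenfunction_cocycle hT1 hS hTS eW eT mF F1 b1 FW chi1 Fchi.
apply: noeig; exists chi; split.
  split.
    split => //.
    exact: (eigencharacter_continuous hS hGhaus hGlc chi1 chiD mg g1 gS).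
  exists b, xi; split => //; apply: filterS xiT => x E.
  have xT : xi (T x) != 0 by rewrite -normr_eq0 xi1 oner_eq0.
  by rewrite mulrA -E mulfK.
exists g; suff [g0 chig0] : exists g0, chi g0 != 1.
  have [hSa _ _] := hS.
  by have [] := unit_eigenfunction_L20 (hSa g0).1 mg g1 chig0 (gS g0).
apply: contrapT => chi_trivial; apply: wT; exists b, xi.
have xib : {ae mu, forall x, xi (T x) = b * xi x}.
  apply: filterS xiT => x <-; rewrite (_ : chi (phi x) = 1) ?mul1r//.
  by apply: contrapT => /eqP n1; apply: chi_trivial; exists (phi x).
by have [] := unit_eigenfunction_L20 hT1 mxi xi1 bn1 xib.
Qed.
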